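(* Let $K$ be a finite field and $\mathbf{F}$ the free group on $r\ge1$ generators. Let $1\ne w=u^d\in\mathbf{F}$ with $d\ge1$ and $u\in\mathbf{F}$ a non-power. For every $m\in\mathbb{Z}_{\ge1}$ and $\mathcal{B}\in\mathrm{GL}_m(K)$, the limit $\lim_{N\to\infty}\mathbb{E}_w[\tilde{\mathcal{B}}]$ exists and (for given $K$ and $\mathcal{B}$) depends only on $d$ and not on $u$.
   Context: For $\mathcal{B}\in\mathrm{GL}_m(K)$ and any $N\ge1$, the function $\tilde{\mathcal{B}}:\mathrm{GL}_N(K)\to\mathbb{Z}_{\ge0}$ is $$\tilde{\mathcal{B}}(g)=\#\{M\in M_{m\times N}(K)\mid Mg=\mathcal{B}M\}.$$ $\mathbf{F}$ has a fixed basis $b_1,\ldots,b_r$, and $w(g_1,\ldots,g_r)$ is the image of $w$ under the homomorphism $b_i\mapsto g_i$. $\mathbb{E}_w[\tilde{\mathcal{B}}]$ is the expected value of $\tilde{\mathcal{B}}(w(g_1,\ldots,g_r))$ where $g_1,\ldots,g_r$ are independent uniformly random elements of $\mathrm{GL}_N(K)$. A non-power is an element $u\neq 1$ not of the form $v^k$ with $v\in\mathbf{F}$, $k\ge2$. *)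

(* Defs.v *)
From HB Require Import structures.
From mathcomp Require Import all_boot all_order all_algebra all_fingroup.
From mathcomp Require Import all_classical all_reals.
From mathcomp Require Import topology normedtype.

Set Implicit Arguments.
Unset Strict Implicit.
Unset Printing Implicit Defensive.

Import Order.TTheory GRing.Theory Num.Theory.
Import numFieldNormedType.Exports.

(** The free group on [b_0, ..., b_(r-1)], realized as the reduced words in the
    letters [b_i^(+-1)]. *)

Section FreeGroup.
Variable r : nat.
Local Open Scope group_scope.

(* (i, false) stands for b_i and (i, true) for its inverse *)
Local Notation letter := ('I_r * bool)%type.

Implicit Types (a b : letter) (s t : seq letter).

Definition linv a : letter := (a.1, ~~ a.2).

Definition reduced s : bool := sorted [rel a b | b != linv a] s.

Definition push a s : seq letter :=
  if s is b :: s' then if b == linv a then s' else a :: s else [:: a].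

Definition word_mul s t : seq letter := foldr push t s.

Definition word_inv s : seq letter := rev (map linv s).

Lemma linvK : involutive linv.
Proof. by case=> i e; rewrite /linv /= negbK. Qed.

Lemma linv_neq a : (a == linv a) = false.
Proof. by case: a => i e; rewrite xpair_eqE eqxx /=; case: e. Qed.

Lemma reduced_cons a s :
  reduced (a :: s) = (if s is b :: _ then b != linv a else true) && reduced s.
Proof. by case: s. Qed.

Lemma reduced_push a s : reduced s -> reduced (push a s).
Proof.
case: s => [//|b s] rs; rewrite /push; case: eqP => [_|/eqP ba].
  by move: rs; rewrite reduced_cons => /andP[].
by rewrite reduced_cons ba.
Qed.

Lemma push_cons a s : reduced (a :: s) -> push a s = a :: s.
Proof. by case: s => [//|b s]; rewrite reduced_cons /= => /andP[/negPf->]. Qed.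

Lemma pushK a s : reduced s -> push (linv a) (push a s) = s.
Proof.
case: s => [|b s] rs; first by rewrite /= linvK eqxx.
rewrite [push a _]/=; case: (eqVneq b (linv a)) rs => [->|_] rs.
  by rewrite push_cons.
by rewrite /= linvK eqxx.
Qed.

Lemma reduced_mul s t : reduced t -> reduced (word_mul s t).
Proof. by move=> rt; elim: s => //= a s; apply: reduced_push. Qed.

Lemma word_mul_push a s t :
  reduced t -> word_mul (push a s) t = push a (word_mul s t).
Proof.
move=> rt; case: s => [//|b s]; rewrite [push a (b :: s)]/=.
case: eqP => [->|//]; rewrite /= -[X in _ = push X _]linvK pushK //.
exact: reduced_mul.
Qed.

Lemma word_mulA s t q :
  reduced q -> word_mul s (word_mul t q) = word_mul (word_mul s t) q.
Proof. by move=> rq; elim: s => //= a s ->; rewrite word_mul_push. Qed.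

Lemma word_muls0 s : reduced s -> word_mul s [::] = s.
Proof.
elim: s => // a s IHs rs; rewrite [word_mul _ _]/= IHs ?push_cons //.
by move: rs; rewrite reduced_cons => /andP[].
Qed.

Lemma reduced_inv s : reduced s -> reduced (word_inv s).
Proof.
rewrite /reduced /word_inv rev_sorted sorted_map; apply: sub_sorted.
by move=> a b /=; rewrite linvK eq_sym (inv_eq linvK).
Qed.

Lemma word_invK : involutive word_inv.
Proof.
by move=> s; rewrite /word_inv map_rev revK -map_comp -[RHS]map_id;
  apply: eq_map => a /=; rewrite linvK.
Qed.

Lemma word_mulVs s : word_mul (word_inv s) s = [::].
Proof.
elim: s => //= a s IHs; rewrite /word_inv map_cons rev_cons -cats1.
by rewrite /word_mul foldr_cat /= linvK eqxx.
Qed.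

Record free_group : Type := FreeWord {
  fg_word :> seq letter;
  fg_wordP : reduced fg_word
}.

HB.instance Definition _ := [isSub for fg_word].
HB.instance Definition _ := [Countable of free_group by <:].

Implicit Types x y z : free_group.

Definition fg_one : free_group := @FreeWord [::] isT.
Definition fg_mul x y : free_group := FreeWord (reduced_mul x (fg_wordP y)).
Definition fg_inv x : free_group := FreeWord (reduced_inv (fg_wordP x)).

Lemma fg_mulA : associative fg_mul.
Proof. by move=> x y z; apply/val_inj/word_mulA/fg_wordP. Qed.

Lemma fg_mul1 : left_id fg_one fg_mul.
Proof. by move=> x; apply: val_inj. Qed.

Lemma fg_mulr1 : right_id fg_one fg_mul.
Proof. by move=> x; apply/val_inj/word_muls0/fg_wordP. Qed.

Lemma fg_mulV : left_inverse fg_one fg_inv fg_mul.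
Proof. by move=> x; apply/val_inj/word_mulVs. Qed.

Lemma fg_mulrV : right_inverse fg_one fg_inv fg_mul.
Proof.
by move=> x; apply: val_inj; rewrite /= -{1}[fg_word x]word_invK word_mulVs.
Qed.

HB.instance Definition _ :=
  isGroup.Build free_group fg_mulA fg_mul1 fg_mulr1 fg_mulV fg_mulrV.

Definition fg_basis (i : 'I_r) : free_group := @FreeWord [:: (i, false)] isT.

(* w(g_0, ..., g_(r-1)); fg_eval_basis, fg_evalM and fg_eval_uniq say that this
   is the image of w under the homomorphism b_i |-> g_i *)
Definition fg_eval (G : groupType) (g : 'I_r -> G) (w : free_group) : G :=
  \prod_(a <- fg_word w) (if a.2 then (g a.1)^-1 else g a.1).

Lemma fg_eval_basis (G : groupType) (g : 'I_r -> G) i :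
  fg_eval g (fg_basis i) = g i.
Proof. by rewrite /fg_eval big_seq1. Qed.

Lemma fg_evalM (G : groupType) (g : 'I_r -> G) :
  {morph fg_eval g : x y / x * y}.
Proof.
move=> x y; rewrite /fg_eval /= /fg_mul /=.
elim: (fg_word x) => [|a s IHs] /=; first by rewrite big_nil mul1g.
rewrite big_cons -mulgA -{}IHs; case: word_mul => [|b t] /=.
  by rewrite big_seq1 big_nil mulg1.
case: eqP => [->|_]; last by rewrite big_cons.
by rewrite big_cons /=; case: a.2; rewrite mulgA ?mulVg ?mulgV mul1g.
Qed.

HB.instance Definition _ (G : groupType) (g : 'I_r -> G) :=
  isMultiplicative.Build free_group G (fg_eval g) (fg_evalM g).

Lemma fg_eval_uniq (G : groupType) (g : 'I_r -> G) (f : free_group -> G) :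
    {morph f : x y / x * y} -> (forall i, f (fg_basis i) = g i) ->
  f =1 fg_eval g.
Proof.
move=> fM fb; have f1 : f 1 = 1.
  by apply: (@mulgI _ (f 1)); rewrite -fM !mulg1.
have fV x : f x^-1 = (f x)^-1.
  by apply: (@mulgI _ (f x)); rewrite -fM !mulgV.
case=> s; elim: s => [|a s IHs] rs.
  by rewrite /fg_eval big_nil -f1; congr f; apply: val_inj.
have rs' : reduced s by move: rs; rewrite reduced_cons => /andP[].
have -> : FreeWord rs =
    (if a.2 then (fg_basis a.1)^-1 else fg_basis a.1) * FreeWord rs'.
  by apply: val_inj => {IHs}; case: a rs => i [] rs /=; rewrite push_cons.
rewrite fM fg_evalM IHs; congr (_ * _).
by case: a.2; rewrite ?fV fb /fg_eval big_seq1.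
Qed.

Definition non_power (u : free_group) : Prop :=
  u <> 1 /\ forall (v : free_group) (k : nat), (2 <= k)%N -> u <> v ^+ k.

End FreeGroup.

Local Open Scope ring_scope.

(* {'GL_n[K]} consists of matrices of size n.-1.+1, which is n as soon as
   0 < n; so M is an m x N matrix when 0 < m and 0 < N, and the value N = 0
   repeats N = 1. *)
Definition count_intertwiners (K : finFieldType) (m : nat) (B : {'GL_m[K]})
    (N : nat) (g : {'GL_N[K]}) : nat :=
  #|[set M : 'M[K]_(m.-1.+1, N.-1.+1) | M *m GLval g == GLval B *m M]|.

(* The average over all r-tuples of elements of GL_N(K), i.e. the expectation
   for independent uniform g_0, ..., g_(r-1) *)
Definition word_expectation (R : realType) (K : finFieldType) (r : nat)
    (w : free_group r) (N : nat) (f : {'GL_N[K]} -> nat) : R :=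
  (\sum_(g : {ffun 'I_r -> {'GL_N[K]}}) (f (fg_eval g w))%:R) /
  #|{ffun 'I_r -> {'GL_N[K]}}|%:R.

(* Main.v *)
Require Import Defs.
From mathcomp Require Import all_classical all_reals.
From mathcomp Require Import topology normedtype sequences.
From mathcomp Require Import all_boot all_order all_algebra all_fingroup.
From mathcomp Require Import zify ring.

(** Write [y = u(g)] and [q = #|K|], and let [N] be the size of the random
    matrices.  A solution [M] of [M y^d = B M] is the same thing as a solution
    [X] of [X y = C X], where [X] stacks [M, M y, ..., M y^(d-1)] and [C] is the
    block companion matrix of [x^d - B] ([card_power_intertwiners]).  The left
    kernel [W] of such an [X] is a [C]-stable subspace, and [X] amounts to a
    matrix with independent rows (a frame) that intertwines [y] with the map
    [C_W] induced by [C] on the quotient by [W]; the map [C_W] is then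
    invertible ([card_intertwiners]).  There are finitely many such [W], they
    depend on [d] and [B] only, and their number is the limit: for every
    non-power [u] and every invertible matrix [C], the expected number of frames
    [M] with [M u(g) = C M] tends to 1 ([frame_expectation_cvg]).

    To see the last point, conjugate [u] to a cyclically reduced word
    [x_0 ... x_(l-1)].  A solution [M] with [k] rows unrolls into [l] blocks
    [X_0 = M, X_1, ...] with [X_j x_j(g) = X_(j+1)], the last block returning
    to [C X_0].  For fixed blocks, the requirement on [g_b] is that it maps the
    blocks at the sources of the edges labelled [b], which span a space
    of dimension [rho_b] say, to the blocks at their targets; if this is
    possible at all then it has probability about [q^(- N rho_b)].  When the
    rows of all blocks are independent, [\sum_b rho_b = l k] compensates exactly
    the [q^(N l k)] choices of the blocks, and these choices contribute 1 in the
    limit.  When the rows satisfy a nonzero space [W] of linear relations, there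
    are [q^(N (l k - dim W))] choices, and [\sum_b rho_b = l k - \sum_b dim (W
    cap V_b)] where [V_b] consists of the relations that involve only the
    sources of [b]-edges.  These choices are negligible because
    [\sum_b dim (W cap V_b) < dim W] ([rank_transport_lt]).

    This inequality comes from a stacking of the cyclic word in the sense of
    Louder and Wilton: a total order of the positions for which any two edges
    with the same label have their sources in the same order as their targets.
    With respect to such an order, the leading terms of the elements of
    [W cap V_b] are carried along the [b]-edges to leading terms of elements of
    [W].  So the edge between two consecutive positions carries at most the
    smaller of the dimensions of the two spaces of leading terms.  Summing over
    the edges gives the weak inequality, and equality would make all
    these dimensions equal; but the one at the lowest position is 0 since every
    single block has independent rows.

    A stacking exists because [u] is not a power ([stacking_exists]).  A weak
    order, starting with the trivial one, turns the cyclic word into a closed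
    walk on a graph.  It can be refined by rational heights, which lift
    the walk to an infinite cyclic covering of the graph, as long as the graph
    has rank at least 2; in rank 1 the graph is a circle, around which a
    non-power runs exactly once. *)

Set Implicit Arguments.
Unset Strict Implicit.
Unset Printing Implicit Defensive.
Import Order.TTheory GRing.Theory Num.Theory.
Import numFieldNormedType.Exports.
Local Open Scope ring_scope.

(** * Stackings of cyclic words *)

(** Dimension count: constant functions have zero coboundary, so the
    coboundaries form a space of dimension at most [#|V| - 1], while the
    functions orthogonal to [z] form a space of dimension at least [#|C| - 1].

    For a graph with vertices [V] and edges [C], and [z] the class of a closed
    walk, this gives a map from the fundamental group to the rationals that
    vanishes on the walk but is not zero. *)
Lemma exists_noncoboundary (V C : finType) (s t : C -> V) (z : C -> rat) :
  (0 < #|V|)%N -> (#|V| < #|C|)%N ->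
  exists2 phi : C -> rat, \sum_c z c * phi c = 0 &
    forall nu : V -> rat, exists c, phi c != nu (t c) - nu (s c).
Proof.
move=> V_gt0 ltVC.
pose zc : 'cV[rat]_#|C| := \col_i z (enum_val i).
pose delta : 'M[rat]_(#|V|, #|C|) := \matrix_(i, j)
  ((enum_val i == t (enum_val j))%:R - (enum_val i == s (enum_val j))%:R).
have deltaE (nu : V -> rat) j :
    ((\row_i nu (enum_val i)) *m delta) 0 j =
    nu (t (enum_val j)) - nu (s (enum_val j)).
  rewrite mxE (eq_bigr (fun i : 'I_#|V| =>
    (if enum_val i == t (enum_val j) then nu (enum_val i) else 0) -
    (if enum_val i == s (enum_val j) then nu (enum_val i) else 0))); last first.
    by move=> i _; rewrite !mxE mulrBr; do 2!case: eqP => _;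
      rewrite ?mulr1 ?mulr0.
  rewrite sumrB -!big_mkcond /=.
  have pickE v : \sum_(i < #|V| | enum_val i == v) nu (enum_val i) = nu v.
    rewrite (big_pred1 (enum_rank v)) ?enum_rankK // => i.
    by rewrite /= -(inj_eq enum_val_inj) enum_rankK.
  by rewrite !pickE.
(* The sum of the rows of [delta] is 0. *)
have rank_delta : (\rank delta < #|V|)%N.
  rewrite -subn_gt0 -mxrank_ker lt0n mxrank_eq0; apply/negP => /eqP ker0.
  have : ((\row_(i < #|V|) (1 : rat)) <= kermx delta)%MS.
    apply/sub_kermxP/rowP => j.
    by rewrite (deltaE (fun=> 1)) mxE subrr.
  rewrite ker0 submx0 => /eqP/rowP/(_ (Ordinal V_gt0)); rewrite !mxE => /eqP.
  by rewrite oner_eq0.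
have : ~~ (kermx zc <= delta)%MS.
  apply/negP => /mxrankS; rewrite mxrank_ker => le_rk.
  have lt_rk := leq_ltn_trans le_rk rank_delta.
  have := leq_ltn_trans (leq_sub2l #|C| (rank_leq_col zc)) lt_rk.
  by rewrite ltn_subLR ?(leq_ltn_trans _ ltVC) // add1n ltnS leqNgt ltVC.
case/row_subPn => i not_cob.
pose phi c := row i (kermx zc) 0 (enum_rank c).
exists phi => [|nu].
  have /rowP/(_ 0) : row i (kermx zc) *m zc = 0.
    by apply/sub_kermxP/row_sub.
  rewrite !mxE => kz; rewrite -[RHS]kz.
  rewrite (reindex (@enum_val C predT)) /=; last first.
    by exists enum_rank => c _; [exact: enum_valK | exact: enum_rankK].
  by apply: eq_bigr => j _; rewrite /phi enum_valK mulrC !mxE.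
apply/existsP; apply: contraR not_cob; rewrite negb_exists => /forallP cob.
apply/submxP; exists (\row_i nu (enum_val i)); apply/rowP => j.
by rewrite deltaE; move/negPn/eqP: (cob (enum_val j)) => <-; rewrite /phi enum_valK.
Qed.

Lemma rank_embedding (I : finType) d (T : orderType d) (f : I -> T) :
  exists h : I -> nat, forall i j, (h i < h j)%N = (f i < f j)%O.
Proof.
exists (fun i => #|[set k | (f k < f i)%O]|) => i j.
case: (ltP (f i) (f j)) => [lt_ij | le_ji].
  apply: proper_card; apply/properP; split.
    by apply/subsetP => k; rewrite !inE => /lt_trans; apply.
  by exists i; rewrite !inE ?ltxx.
apply/negbTE; rewrite -leqNgt; apply: subset_leq_card.
by apply/subsetP => k; rewrite !inE => /lt_le_trans; apply.
Qed.

(** A graph with [#|C|] edges has [2 * #|C|] half-edges, so that [2 * #|V|]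
    of them leave none over when every vertex has its two. *)
Lemma two_half_edges (V C : finType) (en : C * bool -> V) :
    (forall v, exists a b, [/\ a != b, en a = v & en b = v]) ->
    (#|C| <= #|V|)%N ->
  forall a b d, a != b -> en a = en b -> en d = en b -> d = a \/ d = b.
Proof.
move=> deg2 leCV a b d ab ea ed.
have [->|da] := eqVneq d a; first by left.
have [->|db] := eqVneq d b; first by right.
suff : (#|{: C * bool}| > 2 * #|V|)%N.
  by rewrite card_prod card_bool [(_ * 2)%N]mulnC ltn_pmul2l // ltnNge leCV.
have -> : #|{: C * bool}| = (\sum_v #|[set y | en y == v]|)%N.
  rewrite -sum1_card (partition_big en xpredT) //=.
  by apply: eq_bigr => v _; rewrite -sum1dep_card.
rewrite (bigD1 (en b)) //= mulnC -sum_nat_const (bigD1 (en b)) //= -addSn.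
apply: leq_add.
  have sub3 : [set a; b; d] \subset [set y | en y == en b].
    by apply/subsetP => y; rewrite !inE => /orP[/orP[]|] /eqP ->;
      rewrite ?ea ?ed eqxx.
  apply: leq_trans (subset_leq_card sub3).
  by rewrite setUC cardsU1 cards2 !inE negb_or da db ab.
apply: leq_sum => v _; have [y [y' [yy' ey ey']]] := deg2 v.
have sub2 : [set y; y'] \subset [set y | en y == v].
  by apply/subsetP => k; rewrite !inE => /orP[] /eqP ->; apply/eqP.
by apply: leq_trans (subset_leq_card sub2); rewrite cards2 yy'.
Qed.

Lemma val_iter_ordS l k (i : 'I_l) : val (iter k (@ordS l) i) = ((i + k) %% l)%N.
Proof.
elim: k => [|k IHk] /=; first by rewrite addn0 modn_small.
by rewrite IHk -addn1 modnDml addn1 addnS.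
Qed.

Lemma iter_ordS_onto l (i j : 'I_l) : exists2 k, (k < l)%N & iter k (@ordS l) i = j.
Proof.
have l_gt0 : (0 < l)%N by apply: leq_ltn_trans (ltn_ord i).
exists ((j + (l - i)) %% l)%N; first by rewrite ltn_pmod.
apply: val_inj; rewrite val_iter_ordS modnDmr addnCA subnKC ?(ltnW (ltn_ord _)) //.
by rewrite modnDr modn_small.
Qed.

Section Stacking.
Variables (r l : nat) (x : 'I_l -> 'I_r * bool).
Local Notation nxt := (@ordS l).

(** The edge number [j] of the cyclic word [x] joins the position [j] to the next
    one.  It is oriented in such a way that its label is a generator, not the
    inverse of a generator. *)
Definition edge_src j := if (x j).2 then nxt j else j.
Definition edge_tgt j := if (x j).2 then j else nxt j.

(** If [h] is moreover injective, this is a stacking of the cyclic word in the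
    sense of Louder and Wilton. *)
Definition order_compatible (h : 'I_l -> nat) := forall i j, (x i).1 = (x j).1 ->
  (h (edge_src i) < h (edge_src j))%N = (h (edge_tgt i) < h (edge_tgt j))%N.

Hypothesis x_reduced : forall j, x (nxt j) != linv (x j).
Hypothesis x_primitive :
  forall k, (0 < k < l)%N -> exists j, x (iter k nxt j) != x j.

(** The maps [v] and [c] make the cyclic word a closed walk without backtracking in
    a graph, and [(c j, (x j).2)] is the half-edge by which the walk leaves the
    vertex [v j].  By the second hypothesis, a walk that returns to a vertex
    repeats itself from there on, forwards or backwards.  Forwards, the word has
    a rotational symmetry.  Backwards, the two copies of the walk run towards
    each other and meet in an edge or at a vertex, where the walk would have to
    turn around. *)
Lemma degree_two_cycle_inj (V C : eqType) (v : 'I_l -> V) (c : 'I_l -> C) :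
    (forall i j, c i = c j -> [/\ (x i).1 = (x j).1,
       v (edge_src i) = v (edge_src j) & v (edge_tgt i) = v (edge_tgt j)]) ->
    (forall i j, v i = v (nxt j) -> (c i, (x i).2) = (c (nxt j), (x (nxt j)).2)
       \/ (c i, (x i).2) = (c j, ~~ (x j).2)) ->
  injective v.
Proof.
move=> cP det.
have turn p : (c (nxt p), (x (nxt p)).2) <> (c p, ~~ (x p).2).
  case=> /cP[x1 _ _] x2; have /eqP[] := x_reduced p.
  by rewrite [LHS]surjective_pairing x1 x2.
have same_step i j : (c i, (x i).2) = (c j, (x j).2) ->
    (c (nxt i), (x (nxt i)).2) = (c (nxt j), (x (nxt j)).2).
  case=> cij xij; have [_ vs vt] := cP _ _ cij.
  have /det[] // : v (nxt i) = v (nxt j).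
    by move: vs vt; rewrite /edge_src /edge_tgt xij; case: (x j).2.
  by rewrite -cij -xij => /turn.
have back_step e p : (c e, (x e).2) = (c (nxt p), ~~ (x (nxt p)).2) ->
    (c (nxt e), (x (nxt e)).2) = (c p, ~~ (x p).2).
  case=> cep xep; have [_ vs vt] := cP _ _ cep.
  have /det[] // : v (nxt e) = v (nxt p).
    by move: vs vt; rewrite /edge_src /edge_tgt xep; case: (x (nxt p)).2.
  by rewrite -[(x (nxt p)).2]negbK -cep -xep => /turn.
move=> i j vij; apply/eqP/negPn/negP => nij.
have [k k_lt kE] := iter_ordS_onto i j.
have k_gt0 : (0 < k)%N by case: k kE {k_lt} nij => //= ->; rewrite eqxx.
have [q qE] : exists q, nxt q = j by exists (ord_pred j); exact: ord_predK.
rewrite -qE in vij.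
(* [same]: the walk repeats itself forwards; [back]: it runs backwards. *)
case: (det _ _ vij) => [same|back].
  have {}same t : (c (iter t nxt i), (x (iter t nxt i)).2) =
                  (c (iter t nxt j), (x (iter t nxt j)).2).
    by elim: t => [|t /same_step//]; rewrite /= same qE.
  have k_range : (0 < k < l)%N by rewrite k_gt0.
  have [i0 /eqP[]] := x_primitive k_range.
  have [t _ <-] := iter_ordS_onto i i0.
  rewrite -iterD addnC iterD kE; have [ct xt] := same t.
  by have [x1 _ _] := cP _ _ ct; rewrite [RHS]surjective_pairing x1 xt -surjective_pairing.
have {}back t : forall p, iter t.+1 nxt p = j ->
    (c (iter t nxt i), (x (iter t nxt i)).2) = (c p, ~~ (x p).2).
  elim: t => [|t IHt] p pE; last by apply/back_step/IHt; rewrite -pE -iterSr.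
  by rewrite -[p](@ordSK l) [nxt p]pE -qE ordSK.
(* For odd [k] the two copies of the walk meet in an edge that is traversed in
   both directions, and for even [k] at a vertex between inverse edges. *)
have [t kt] : exists t, k = t.*2.+1 \/ k = t.*2.+2.
  exists (k.-1)./2; case: (k) k_gt0 => // k' _ /=.
  by move: (odd_double_half k'); case: (odd k') => /= k'E; [right|left];
    rewrite -{1}k'E.
case: kt => kt.
  have /back[/eqP] : iter t.+1 nxt (iter t nxt i) = j.
    by rewrite -iterD -kE kt addSn addnn.
  by case: (x _).2.
have /back/turn[] : iter t.+2 nxt (iter t nxt i) = j.
by rewrite -iterD -kE kt !addSn addnn.
Qed.

Lemma cycle_potential (f : 'I_l -> rat) : \sum_j f j = 0 ->
  exists n : 'I_l -> rat, forall j, n (nxt j) - n j = f j.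
Proof.
move=> f0; exists (fun j => \sum_(i < l | (i < j)%N) f i) => j.
have splitj : \sum_(i < l | (i < j.+1)%N) f i = f j + \sum_(i < l | (i < j)%N) f i.
  rewrite (bigD1 j) //=; congr (_ + _); apply: eq_bigl => i.
  by rewrite ltnS ltn_neqAle andbC.
suff -> : \sum_(i < l | (i < nxt j)%N) f i = \sum_(i < l | (i < j.+1)%N) f i.
  by rewrite splitj addrK.
have := ltn_ord j; rewrite leq_eqVlt => /orP[/eqP jl|jl] /=; last by rewrite modn_small.
rewrite jl modnn big_pred0 // -[LHS]f0; apply: eq_bigl => i.
by rewrite ltn_ord.
Qed.

(** The values of [h] are the vertices of a graph on which the cyclic word walks,
    with one edge for each generator and source; [order_compatible h] says that
    the target of an edge is well defined.  If this graph does not have more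
    edges than vertices, then it is a circle around which a primitive word runs
    once, and [h] is injective.  Otherwise there are edge lengths [phi] for
    which the walk closes up although they are not differences of heights of
    vertices.  The heights [n] reached along the walk serve to break
    the ties of [h]: two edges that are tied have the same length, so that [n]
    orders their sources and their targets in the same way. *)
Lemma refine_order h : order_compatible h -> ~ injective h ->
  exists h', [/\ order_compatible h', forall i j, h' i = h' j -> h i = h j &
    exists i j, h i = h j /\ h' i <> h' j].
Proof.
move=> hc ninj; pose c j := ((x j).1, h (edge_src j)).
have cP i j : c i = c j -> [/\ (x i).1 = (x j).1,
    h (edge_src i) = h (edge_src j) & h (edge_tgt i) = h (edge_tgt j)].
  move=> [xij hs]; split=> //.
  by case: (ltngtP (h (edge_tgt i)) (h (edge_tgt j))) => //;
    rewrite -hc // hs ltnn.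
pose V : finType := seq_sub (codom h); pose C : finType := seq_sub (codom c).
pose v (j : 'I_l) : V := SeqSub (codom_f h j).
pose e (j : 'I_l) : C := SeqSub (codom_f c j).
have v_onto (a : V) : exists j, v j = a.
  by case: a => a aP; have /codomP[j aj] := aP; exists j; apply: val_inj.
have e_onto (a : C) : exists j, e j = a.
  by case: a => a aP; have /codomP[j aj] := aP; exists j; apply: val_inj.
have [rep repK] := fin_all_exists e_onto.
have eP i j : e i = e j -> [/\ (x i).1 = (x j).1,
    v (edge_src i) = v (edge_src j) & v (edge_tgt i) = v (edge_tgt j)].
  move=> /(congr1 (@ssval _ _)) /cP[-> hs ht].
  by split=> //; apply: val_inj.
have e_src j : v (edge_src (rep (e j))) = v (edge_src j).
  by have [] := eP _ _ (repK (e j)).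
have e_tgt j : v (edge_tgt (rep (e j))) = v (edge_tgt j).
  by have [] := eP _ _ (repK (e j)).
pose en (y : C * bool) :=
  if y.2 then v (edge_tgt (rep y.1)) else v (edge_src (rep y.1)).
have en_out j : en (e j, (x j).2) = v j.
  by rewrite /en /= e_src e_tgt /edge_src /edge_tgt; case: (x j).2.
have en_in j : en (e j, ~~ (x j).2) = v (nxt j).
  by rewrite /en /= e_src e_tgt /edge_src /edge_tgt; case: (x j).2.
have turn j : (e (nxt j), (x (nxt j)).2) != (e j, ~~ (x j).2).
  rewrite xpair_eqE; apply/negP => /andP[/eqP/eP[x1 _ _] /eqP x2].
  have /eqP[] := x_reduced j.
  by rewrite [LHS]surjective_pairing x1 x2.
have [leCV|ltVC] := leqP #|C| #|V|.
  have deg2 a : exists y y', [/\ y != y', en y = a & en y' = a].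
    have [j <-] := v_onto a; rewrite -(ord_predK j); set q := ord_pred j.
    exists (e (nxt q), (x (nxt q)).2), (e q, ~~ (x q).2).
    by rewrite turn en_out en_in.
  case: ninj => i j hij; apply: (@degree_two_cycle_inj _ _ v e) => //; last first.
    exact: val_inj.
  move=> {hij}i {}j vij; apply: (two_half_edges deg2 leCV (turn j)).
    by rewrite en_out en_in.
  by rewrite en_out en_in.
(* The multiplicity of an edge in the closed walk is the sum of the signs of its
   traversals. *)
pose sg j : rat := if (x j).2 then -1 else 1.
have [|phi phi0 ncob] := @exists_noncoboundary V C
    (fun a => v (edge_src (rep a))) (fun a => v (edge_tgt (rep a)))
    (fun a => \sum_(j | e j == a) sg j) _ ltVC.
  rewrite lt0n; apply: contra_notN ninj => /eqP/card0_eq V0.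
  by move=> i; have := V0 (v i).
have [n nP] : exists n : 'I_l -> rat, forall j, n (nxt j) - n j = sg j * phi (e j).
  apply: cycle_potential; rewrite -[RHS]phi0 (partition_big e xpredT) //=.
  by apply: eq_bigr => a _; rewrite mulr_suml; apply: eq_bigr => j /eqP->.
have {}nP j : n (edge_tgt j) - n (edge_src j) = phi (e j).
  have := nP j; rewrite /edge_tgt /edge_src /sg; case: (x j).2; rewrite ?mul1r //.
  by rewrite mulN1r => /(congr1 -%R); rewrite opprB opprK.
(* Refine [h] by comparing heights lexicographically. *)
have [h' h'P] := rank_embedding (fun j => ((h j, n j) : (nat *l rat)%type)).
have h'E i j : (h' i < h' j)%N = (h i < h j)%N || (h i == h j) && (n i < n j).
  by rewrite h'P ltEprodlexi /= !leEnat; case: ltngtP.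
have h'_eq i j : h' i = h' j -> h i = h j /\ n i = n j.
  move=> h'ij; have := h'E i j; have := h'E j i; rewrite h'ij ltnn.
  by case: (ltngtP (h i) (h j)) => //= ->; case: (ltgtP (n i) (n j)).
exists h'; split=> [i j xij|i j /h'_eq[]//|].
  have sign_eq : (h (edge_src i) == h (edge_src j)) = (h (edge_tgt i) == h (edge_tgt j)).
    have := hc i j xij; have := hc j i (esym xij).
    by case: (ltngtP (h (edge_src i))) => _; case: (ltngtP (h (edge_tgt i))).
  rewrite !h'E (hc i j) // sign_eq; congr (_ || _).
  have [ht|//] := eqVneq; have hs : h (edge_src i) = h (edge_src j).
    by case: (ltngtP (h (edge_src i)) (h (edge_src j))) => //;
      rewrite hc // ht ltnn.
  have eij : e i = e j by apply: val_inj; rewrite /= /c xij hs.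
  have tgtE q : n (edge_tgt q) = phi (e q) + n (edge_src q) by rewrite -nP subrK.
  by rewrite !tgtE eij ltrD2l.
have [/existsP[i /existsP[j /andP[/eqP hij nij]]]|no] :=
    boolP [exists i, exists j, (h i == h j) && (n i != n j)].
  by exists i, j; split=> // /h'_eq[_ /eqP]; rewrite (negPf nij).
(* If the heights are determined by [h], then [phi] is the coboundary of a function on
   the vertices. *)
have [repv repvK] := fin_all_exists v_onto.
have n_v j : n (repv (v j)) = n j.
  apply/eqP; apply: contraNT no => nj; apply/existsP; exists (repv (v j)).
  apply/existsP; exists j; rewrite nj andbT.
  by apply/eqP; have /(congr1 (@ssval _ _)) := repvK (v j).
have [a /eqP[]] := ncob (n \o repv).
by rewrite /= !n_v nP repK.
Qed.

(** Every refinement separates a pair of positions, so repeated refinement of the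
    constant function ends with an injective one. *)
Theorem stacking_exists :
  exists h : 'I_l -> nat, order_compatible h /\ injective h.
Proof.
suff main k : forall h, order_compatible h ->
    (#|[set p : 'I_l * 'I_l | h p.1 == h p.2]| < k)%N ->
    exists h' : 'I_l -> nat, order_compatible h' /\ injective h'.
  by apply: (main _.+1 (fun=> 0%N)) => //.
elim: k => // k IHk h hc hk.
have [/injectiveP|/injectiveP ninj] := boolP (injectiveb h); first by exists h.
have [h' [h'c h'h [i [j [hij h'ij]]]]] := refine_order hc ninj.
rewrite ltnS in hk; apply: (IHk h') => //; apply: leq_trans hk.
apply: proper_card; apply/properP.
split; first by apply/subsetP => p; rewrite !inE => /eqP/h'h/eqP.
by exists (i, j); rewrite inE /= ?hij ?eqxx //; apply/eqP.
Qed.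

End Stacking.

(** * Relations between blocks of rows *)

Section Blocks.
Variables (K : fieldType) (l k : nat).

(** Row vectors of length [l * k] consist of [l] blocks of length [k]:
    multiplying by [blk_out j] on the right extracts the block [j], and
    multiplying by [blk_in j] puts a vector into the block [j] of a vector that
    is 0 elsewhere.  For a matrix [X] with [l * k] rows, [blk_in j *m X] consists of
    the rows in the block [j]. *)
Definition blk_in j : 'M[K]_(k, l * k) :=
  \matrix_(i, y) (y == mxvec_index j i)%:R.
Definition blk_out j : 'M[K]_(l * k, k) := (blk_in j)^T.

Lemma mxvec_index_eq (i j : 'I_l) (a b : 'I_k) :
  (mxvec_index i a == mxvec_index j b) = ((i, a) == (j, b)).
Proof. by rewrite (inj_eq (@cast_ord_inj _ _ _)) (inj_eq enum_rank_inj). Qed.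

Lemma blk_inK j : blk_in j *m blk_out j = 1%:M.
Proof.
apply/matrixP => a b; rewrite !mxE (bigD1 (mxvec_index j a)) //= !mxE eqxx mul1r.
rewrite big1 ?addr0 => [|y ya]; last by rewrite !mxE (negPf ya) mul0r.
by rewrite mxvec_index_eq xpair_eqE eqxx.
Qed.

Lemma blk_in_out i j : i != j -> blk_in i *m blk_out j = 0.
Proof.
move=> ij; apply/matrixP => a b; rewrite !mxE big1 // => y _; rewrite !mxE.
case: eqP => [->|_]; last by rewrite mul0r.
by rewrite mul1r mxvec_index_eq xpair_eqE (negPf ij).
Qed.

Lemma sum_blk_out_in : \sum_j blk_out j *m blk_in j = 1%:M.
Proof.
apply/matrixP => y y'; rewrite summxE !mxE; case/mxvec_indexP: y => j a.
rewrite (bigD1 j) //= mxE (bigD1 a) //= !mxE eqxx mul1r eq_sym.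
rewrite big1 => [|b ba]; last first.
  by rewrite !mxE mxvec_index_eq xpair_eqE eqxx eq_sym (negPf ba) mul0r.
rewrite big1 ?addr0 // => i ij; rewrite mxE big1 // => b _.
by rewrite !mxE mxvec_index_eq xpair_eqE eq_sym (negPf ij) mul0r.
Qed.

(** The projection to the blocks in [S]; its row space consists of the vectors
    that vanish outside of these blocks. *)
Definition blk_span (S : pred 'I_l) : 'M[K]_(l * k) :=
  \sum_(j | S j) blk_out j *m blk_in j.

Lemma blk_span_out S j : blk_span S *m blk_out j = if S j then blk_out j else 0.
Proof.
rewrite /blk_span mulmx_suml big_mkcond (bigD1 j) //= big1 => [|i ij].
  by case: ifP => // _; rewrite ?addr0 // -mulmxA blk_inK mulmx1.
by case: ifP => // _; rewrite -mulmxA blk_in_out // mulmx0.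
Qed.

Lemma blk_in_span S j : blk_in j *m blk_span S = if S j then blk_in j else 0.
Proof.
rewrite /blk_span mulmx_sumr big_mkcond (bigD1 j) //= big1 => [|i ij].
  by case: ifP => // _; rewrite ?addr0 // mulmxA blk_inK mul1mx.
by case: ifP => // _; rewrite mulmxA blk_in_out ?mul0mx // eq_sym.
Qed.

Lemma sub_blk_span p (A : 'M_(p, l * k)) S :
  reflect (forall j, ~~ S j -> A *m blk_out j = 0) (A <= blk_span S)%MS.
Proof.
apply: (iffP idP) => [/submxP[D ->] j /negPf Sj|A0].
  by rewrite -mulmxA blk_span_out Sj mulmx0.
apply/submxP; exists A; rewrite -[LHS]mulmx1 -sum_blk_out_in.
rewrite (bigID S) /= mulmxDr [X in _ + X]mulmx_sumr.
by rewrite [X in _ + X]big1 ?addr0 // => j /A0; rewrite mulmxA => ->; rewrite mul0mx.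
Qed.

Lemma eq_blk_out p (A B : 'M_(p, l * k)) :
  (forall j, A *m blk_out j = B *m blk_out j) -> A = B.
Proof.
move=> AB; rewrite -[A]mulmx1 -[B]mulmx1 -sum_blk_out_in !mulmx_sumr.
by apply: eq_bigr => j _; rewrite !mulmxA AB.
Qed.

Lemma eq_blk_in p (A B : 'M_(l * k, p)) :
  (forall j, blk_in j *m A = blk_in j *m B) -> A = B.
Proof.
move=> AB; rewrite -[A]mul1mx -[B]mul1mx -sum_blk_out_in !mulmx_suml.
by apply: eq_bigr => j _; rewrite -!mulmxA AB.
Qed.

Section Leading.
Variable h : 'I_l -> nat.
Hypothesis h_inj : injective h.

(** The space of leading blocks at [j]: the blocks [j] of those vectors in the row
    space of [W] that have no nonzero block above [j] in the order given by
    [h]. *)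
Definition lead p (W : 'M_(p, l * k)) j : 'M_(_, k) :=
  (W :&: blk_span (fun i => h i <= h j)%N)%MS *m blk_out j.

(** The spaces of leading blocks are the graded pieces of the filtration of [W]
    by the position of the highest nonzero block. *)
Lemma rank_lead p (W : 'M_(p, l * k)) : \rank W = (\sum_j \rank (lead W j))%N.
Proof.
pose trunc t := (W :&: blk_span (fun i => h i < t)%N)%MS.
suff main t : \rank (trunc t) = (\sum_(j | (h j < t)%N) \rank (lead W j))%N.
  have hlt j : (h j < (\max_i h i).+1)%N = true by rewrite ltnS leq_bigmax.
  rewrite -(eq_bigl _ _ hlt) -main.
  apply/esym/eqmx_rank/eqmxP/capmx_idPl/sub_blk_span => j.
  by rewrite hlt.
elim: t => [|t IHt].
  rewrite big_pred0_eq; apply/eqP; rewrite mxrank_eq0 -submx0 /trunc.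
  by rewrite /blk_span big_pred0_eq capmx0.
have [j hj|noj] := pickP (fun j => h j == t); last first.
  have same j : (h j < t.+1)%N = (h j < t)%N by rewrite ltnS leq_eqVlt noj.
  by rewrite (eq_bigl _ _ same) -IHt /trunc /blk_span (eq_bigl _ _ same).
have {hj} hjt := eqP hj; rewrite (bigD1 j) /=; last by rewrite hjt.
rewrite (eq_bigl (fun i => h i < t)%N) => [|i]; last first.
  by rewrite ltnS [RHS]ltn_neqAle andbC -hjt (inj_eq h_inj).
(* Taking the block [j] of the vectors in [trunc t.+1] has kernel [trunc t]. *)
have -> : trunc t.+1 = (W :&: blk_span (fun i => h i <= h j)%N)%MS by rewrite hjt.
rewrite -(mxrank_mul_ker _ (blk_out j)) -IHt; congr addn.
set X := (_ :&: kermx _)%MS.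
have XW : (X <= W)%MS by rewrite (submx_trans (capmxSl _ _)) ?capmxSl.
have XE : (X <= blk_span (fun i => h i <= h j)%N)%MS.
  by rewrite (submx_trans (capmxSl _ _)) ?capmxSr.
have Xj : X *m blk_out j = 0 by apply/sub_kermxP/capmxSr.
have YE : (trunc t <= blk_span (fun i => h i < t)%N)%MS := capmxSr _ _.
apply/eqmx_rank; rewrite !sub_capmx XW capmxSl /=; apply/and3P; split.
- apply/sub_blk_span => i; rewrite -leqNgt -hjt leq_eqVlt (inj_eq h_inj).
  by case/orP => [/eqP <- //|ji]; apply: (sub_blk_span _ _ XE); rewrite -ltnNge.
- apply/sub_blk_span => i; rewrite -ltnNge hjt => /ltnW ti.
  by apply: (sub_blk_span _ _ YE); rewrite -leqNgt.
by apply/sub_kermxP/(sub_blk_span _ _ YE); rewrite hjt ltnn.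
Qed.

Lemma lead_sub p q (U : 'M_(p, l * k)) (W : 'M_(q, l * k)) j :
  (U <= W)%MS -> (lead U j <= lead W j)%MS.
Proof. by move=> UW; rewrite submxMr // capmxS. Qed.
End Leading.

Lemma rank_blk_span S : \rank (blk_span S) = (\sum_(j | S j) k)%N.
Proof.
rewrite (rank_lead (@ord_inj l)) big_mkcond [RHS]big_mkcond; apply: eq_bigr => j _.
case: ifPn => Sj; last first.
  apply/eqP; rewrite mxrank_eq0 -submx0.
  apply: submx_trans (submxMr _ (capmxSl _ _)) _.
  by rewrite blk_span_out (negPf Sj) sub0mx.
apply/eqP; rewrite eqn_leq rank_leq_col /= -[X in (X <= _)%N](mxrank1 K k).
rewrite -(blk_inK j) mxrankS // submxMr // sub_capmx.
by apply/andP; split; apply/submxP; exists (blk_in j); rewrite blk_in_span ?Sj ?leqnn.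
Qed.

Section Transport.
Variables (r : nat) (x : 'I_l -> 'I_r * bool) (A : 'I_l -> 'M[K]_k).
Hypothesis x_reduced : forall j, x (ordS j) != linv (x j).
Local Notation src := (edge_src x).
Local Notation tgt := (edge_tgt x).

(** Two edges with the same label and the same source would be consecutive and
    inverse to each other. *)
Lemma edge_src_inj i j : (x i).1 = (x j).1 -> src i = src j -> i = j.
Proof.
rewrite /edge_src => xij; case xi: (x i).2; case xj: (x j).2.
- exact: ordS_inj.
- move=> ij; have /eqP[] := x_reduced i; rewrite ij.
  by rewrite [LHS]surjective_pairing -xij xj /linv xi.
- move=> ij; have /eqP[] := x_reduced j; rewrite -ij.
  by rewrite [LHS]surjective_pairing xij xi /linv xj.
by [].
Qed.

Lemma edge_tgt_inj i j : (x i).1 = (x j).1 -> tgt i = tgt j -> i = j.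
Proof.
rewrite /edge_tgt => xij; case xi: (x i).2; case xj: (x j).2.
- by [].
- move=> ij; have /eqP[] := x_reduced j; rewrite -ij.
  by rewrite [LHS]surjective_pairing xij xi /linv xj.
- move=> ij; have /eqP[] := x_reduced i; rewrite ij.
  by rewrite [LHS]surjective_pairing -xij xj /linv xi.
exact: ordS_inj.
Qed.

Definition gen_src b : pred 'I_l := fun i => [exists j, ((x j).1 == b) && (src j == i)].

(** Moves the block at the source of each edge labelled [b] to its target,
    with the matrix [A] of this edge. *)
Definition transport b : 'M[K]_(l * k) :=
  \sum_(j | (x j).1 == b) blk_out (src j) *m A j *m blk_in (tgt j).

Lemma gen_srcP j : gen_src (x j).1 (src j).
Proof. by apply/existsP; exists j; rewrite !eqxx. Qed.

Lemma big_gen_src (T : Type) (idx : T) (op : Monoid.com_law idx) (F : 'I_l -> T) b :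
  \big[op/idx]_(i | gen_src b i) F i = \big[op/idx]_(j | (x j).1 == b) F (src j).
Proof.
rewrite -(big_imset (h := src) (A := [pred j | (x j).1 == b])) /=; last first.
  by move=> i j; rewrite !inE => /eqP xi /eqP xj; apply: edge_src_inj; rewrite xi.
apply: eq_bigl => i; apply/existsP/imsetP => [[j /andP[xj /eqP]]|[j xj ->]].
  by exists j.
by exists j; rewrite eqxx andbT.
Qed.

Lemma blk_in_transport j : blk_in (src j) *m transport (x j).1 = A j *m blk_in (tgt j).
Proof.
rewrite mulmx_sumr (bigD1 j) //= big1 ?addr0 => [|i /andP[/eqP xi ij]].
  by rewrite !mulmxA blk_inK mul1mx.
rewrite !mulmxA blk_in_out ?mul0mx //; apply: contraNneq ij => /edge_src_inj ->//.
Qed.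

Lemma transport_out j : transport (x j).1 *m blk_out (tgt j) = blk_out (src j) *m A j.
Proof.
rewrite mulmx_suml (bigD1 j) //= big1 ?addr0 => [|i /andP[/eqP xi ij]].
  by rewrite -!mulmxA blk_inK mulmx1.
by rewrite -!mulmxA blk_in_out ?mulmx0 //; apply: contraNneq ij => /edge_tgt_inj ->.
Qed.

Hypothesis A_unit : forall j, A j \in unitmx.
Variables (h : 'I_l -> nat) (h_inj : injective h) (hc : order_compatible x h).

(** Let [d j] be the dimension of the space of leading blocks that the edge [j]
    carries from its source to its target, and let [q j] be the dimension of the
    space of leading blocks of [W] at the position [j].  As [h] is compatible
    with the edges, transport maps leading blocks to leading blocks.
    Hence [d j] is at most [q j] and at most [q (ordS j)], and
    the two sides of the inequality are the sums of [d] and of [q].  If it failed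
    then [q] would be constant around the cycle.  But [q] vanishes at the lowest
    position, because no nonzero vector of [W] lives in a single block. *)
Theorem rank_transport_lt p (W : 'M_(p, l * k)) :
    (forall b, (W :&: blk_span (gen_src b))%MS *m transport b <= W)%MS ->
    (forall j, W :&: blk_span (pred1 j) = 0)%MS ->
    W != 0 ->
  (\sum_b \rank (W :&: blk_span (gen_src b))%MS < \rank W)%N.
Proof.
move=> stable trivial W_neq0.
pose D b := (W :&: blk_span (gen_src b))%MS.
pose d j := \rank (lead h (D (x j).1) (src j)); pose q j := \rank (lead h W j).
have sumD : (\sum_b \rank (D b) = \sum_j d j)%N.
  rewrite (partition_big (fun j => (x j).1) xpredT) //=; apply: eq_bigr => b _.
  rewrite (rank_lead h_inj) (bigID (gen_src b)) /= [X in (_ + X)%N]big1 => [|i bi].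
    by rewrite addn0 big_gen_src; apply: eq_bigr => j /eqP jb; rewrite /d jb.
  have Di : D b *m blk_out i = 0 by apply: (sub_blk_span _ _ (capmxSr _ _)).
  apply/eqP; rewrite mxrank_eq0 -submx0.
  by apply: submx_trans (submxMr _ (capmxSl _ _)) _; rewrite Di sub0mx.
have d_src j : (d j <= q (src j))%N by rewrite mxrankS ?lead_sub ?capmxSl.
have d_tgt j : (d j <= q (tgt j))%N.
  rewrite /d /q /lead -(mxrankMfree _ (B := A j)) ?row_free_unit //; apply: mxrankS.
  set U := (D _ :&: blk_span (fun i => (h i <= h (src j))%N))%MS.
  rewrite -mulmxA -transport_out mulmxA; apply: submxMr; rewrite sub_capmx.
  have UW : (U *m transport (x j).1 <= W)%MS.
    by apply: submx_trans (submxMr _ (capmxSl _ _)) (stable _).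
  rewrite UW /=; apply/sub_blk_span => i; rewrite -ltnNge => hi.
  (* Another [b]-edge [j'] that ends above the target of [j] starts above the
     source of [j], where the vectors in [U] vanish. *)
  rewrite mulmx_sumr mulmx_suml big1 // => j' /eqP xj'.
  have [le_j'|gt_j'] := leqP (h (src j')) (h (src j)).
    have [ti|ti] := eqVneq (tgt j') i; last by rewrite -!mulmxA blk_in_out ?mulmx0.
    by move: hi; rewrite -ti -hc ?xj' // ltnNge le_j'.
  by rewrite !mulmxA (sub_blk_span _ _ (capmxSr _ _)) ?mul0mx // -ltnNge.
rewrite -/D sumD (rank_lead h_inj W) ltnNge; apply/negP => le_qd.
have d_le j : (d j <= q j <= q j)%N && (d j <= q (ordS j))%N.
  have := d_src j; have := d_tgt j; rewrite /edge_src /edge_tgt leqnn.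
  by case: (x j).2 => -> ->.
have q_step j : (q j <= q (ordS j))%N.
  have leif_dq i : true -> (d i <= q i ?= iff (d i == q i))%N.
    by split=> //; have /andP[/andP[]] := d_le i.
  have /andP[_ +] := d_le j; suff /eqP -> : d j == q j by [].
  have := geq_leqif (leqif_sum leif_dq); rewrite le_qd => /esym/forallP/(_ j).
  exact.
have q_mono i j : (q i <= q j)%N.
  have [t _ <-] := iter_ordS_onto i j.
  by elim: t => [|t IHt] //=; apply: leq_trans IHt (q_step _).
have q0 j : q j = 0%N.
  have [j0 _ j0_min] := arg_minnP h (isT : xpredT j).
  have pred1E : blk_span (fun i => h i <= h j0)%N = blk_span (pred1 j0).
    apply: eq_bigl => i; apply/idP/eqP => [le_i|->//]; apply: h_inj.
    by apply/eqP; rewrite eqn_leq le_i j0_min.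
  apply/eqP; rewrite -leqn0; apply: leq_trans (q_mono j j0) _.
  by rewrite /q /lead pred1E trivial mul0mx mxrank0.
move: W_neq0; rewrite -mxrank_eq0 (rank_lead h_inj) big1 ?eqxx // => j _.
exact: q0.
Qed.

End Transport.

End Blocks.

(** * Counting matrices with prescribed kernel or image *)

Section MatrixCounting.
Variable K : finFieldType.
Local Notation q := #|K|.

(** The columns of [X] lie in the right kernel of [a]. *)
Lemma card_annihilated p s N (a : 'M[K]_(p, s)) :
  (#|[set X : 'M[K]_(s, N) | a *m X == 0%R]| <= q ^ ((s - \rank a) * N))%N.
Proof.
set t := \rank (kermx a^T); have tE : t = (s - \rank a)%N.
  by rewrite /t mxrank_ker mxrank_tr.
have sub : [set X : 'M[K]_(s, N) | a *m X == 0] \subset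
    [set (Y *m row_base (kermx a^T))^T | Y in [set: 'M[K]_(N, t)]].
  apply/subsetP => X; rewrite inE => /eqP aX.
  have : (X^T <= row_base (kermx a^T))%MS.
    by rewrite eq_row_base; apply/sub_kermxP; rewrite -trmx_mul aX trmx0.
  case/submxP => Y XY; apply/imsetP; exists Y; first by rewrite inE.
  by rewrite -XY trmxK.
apply: leq_trans (subset_leq_card sub) _; apply: leq_trans (leq_imset_card _ _) _.
by rewrite cardsT card_mx -tE mulnC.
Qed.

Definition frames s N : {set 'M[K]_(s, N)} := [set X | row_free X].

Lemma card_frames_le s N : (#|frames s N| <= q ^ (s * N))%N.
Proof. by rewrite -card_mx max_card. Qed.

(** Union bound: dependent rows satisfy one of at most [q ^ s] nonzero relations,
    and each of these holds for at most [q ^ (s.-1 * N)] matrices. *)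
Lemma card_frames_ge s N :
  (q ^ (s * N) <= #|frames s N| + q ^ s * q ^ (s.-1 * N))%N.
Proof.
rewrite -[X in (X <= _)%N](card_mx K s N) -(cardC (mem (frames s N))) leq_add2l.
have -> : #|[predC frames s N]| = (\sum_(X in [predC frames s N]) 1)%N.
  by rewrite sum1_card.
pose bad (a : 'rV[K]_s) (X : 'M[K]_(s, N)) := (a != 0) && (a *m X == 0).
apply: (@leq_trans (\sum_a \sum_X bad a X)).
  rewrite exchange_big big_mkcond; apply: leq_sum => X _; case: ifP => // XF.
  have [i ki] : exists i, row i (kermx X) != 0.
    apply/existsP; apply: contraLR XF; rewrite negb_exists => /forallP k0.
    rewrite !inE negbK -kermx_eq0; apply/eqP/row_matrixP => i.
    by rewrite row0; apply/eqP/negPn.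
  rewrite (bigD1 (row i (kermx X))) //= /bad ki.
  suff -> : row i (kermx X) *m X == 0 by [].
  by apply/eqP/sub_kermxP/row_sub.
apply: (@leq_trans (\sum_(a : 'rV[K]_s) q ^ (s.-1 * N))%N); last first.
  by rewrite sum_nat_const card_mx mul1n.
apply: leq_sum => a _; rewrite /bad; have [->|a0] := eqVneq a 0.
  by rewrite big1.
rewrite (eq_bigr (fun X => if a *m X == 0 then 1%N else 0%N)); last first.
  by move=> X _; case: (_ == _).
rewrite -big_mkcond sum1dep_card; apply: leq_trans (card_annihilated N a) _.
by rewrite rank_rV a0 subn1.
Qed.

Variable N : nat.
Local Notation G := {'GL_N.+1[K]}.
Implicit Type g : G.

Lemma frames_trans s (X Y : 'M[K]_(s, N.+1)) : row_free X -> row_free Y ->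
  exists g : G, X *m GLval g = Y.
Proof.
move=> /row_freeP[B XB] rfY.
have XBY : X *m (B *m Y) = Y by rewrite mulmxA XB mul1mx.
have rfX : row_free X by apply/row_freeP; exists B.
have [|g g_unit gE] := @complete_unitmx _ _ _ X (B *m Y).
  by rewrite XBY (eqP rfX) (eqP rfY).
by exists (Sub g g_unit); rewrite /= -gE XBY.
Qed.

Lemma frames_act s (X : 'M[K]_(s, N.+1)) g : row_free (X *m GLval g) = row_free X.
Proof. by rewrite /row_free mxrankMfree // row_free_unit (valP g). Qed.

(** Only the restriction of [g] to the row space of [X] matters, which is
    spanned by a frame [R].  By transitivity, the number of [g] that map [R] to a
    given frame does not depend on that frame. *)
Lemma card_GL_transporter s (X Y : 'M[K]_(s, N.+1)) g0 : X *m GLval g0 = Y ->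
  (#|[set g : G | X *m GLval g == Y]| * #|frames (\rank X) N.+1| = #|{: G}|)%N.
Proof.
move=> XY; set R := row_base X; have rfR : row_free R by apply: row_base_free.
pose S (Y' : 'M_(\rank X, N.+1)) := [set g : G | R *m GLval g == Y'].
have card_S Y' : row_free Y' -> #|S Y'| = #|S R|.
  case/(frames_trans rfR) => h hE; rewrite -[RHS](card_imset _ (mulIg h)).
  apply: eq_card => g; rewrite inE; apply/eqP/imsetP => [gE|[g' g'S ->]].
    exists (g * h^-1)%g; last by rewrite mulgKV.
    by rewrite inE /S GL_ME GL_VxE mulmxA gE -hE -mulmxA mulmxV ?mulmx1 // (valP h).
  by move: g'S; rewrite inE GL_ME mulmxA => /eqP ->.
have [P PX] : exists P, R = P *m X.
  by apply/submxP; rewrite /R eq_row_base.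
have [P' XP'] : exists P', X = P' *m R.
  by apply/submxP; rewrite /R eq_row_base.
have -> : [set g : G | X *m GLval g == Y] = S (R *m GLval g0).
  apply/setP => g; rewrite !inE -XY; apply/eqP/eqP => gE.
    by rewrite PX -!mulmxA gE.
  by rewrite XP' -[LHS]mulmxA -[RHS]mulmxA gE.
rewrite card_S ?frames_act //.
rewrite -[#|{: G}|]sum1_card.
rewrite (partition_big (fun g => R *m GLval g) (mem (frames (\rank X) N.+1))) /=.
  rewrite mulnC -sum_nat_const; apply: eq_bigr => Y'; rewrite inE => /card_S <-.
  by rewrite -sum1dep_card.
by move=> g _; rewrite inE frames_act.
Qed.

Lemma card_GL_transporter_le s (X Y : 'M[K]_(s, N.+1)) :
  (#|[set g : G | X *m GLval g == Y]| * #|frames (\rank X) N.+1| <= #|{: G}|)%N.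
Proof.
have [->|[g]] := set_0Vmem [set g : G | X *m GLval g == Y]; first by rewrite cards0.
by rewrite inE => /eqP/card_GL_transporter ->.
Qed.

End MatrixCounting.

(** * Solutions of a cyclic system of equations *)

Lemma card_ffun_forall (I T : finType) (S : I -> {set T}) :
  #|[set g : {ffun I -> T} | [forall i, g i \in S i]]| = (\prod_i #|S i|)%N.
Proof.
rewrite (eq_bigr (fun i => \sum_(y : T) (y \in S i : nat))%N); last first.
  by move=> i _; rewrite -sum1_card big_mkcond; apply: eq_bigr => y _; case: ifP.
rewrite bigA_distr_bigA -sum1dep_card big_mkcond; apply: eq_bigr => g _.
case: ifPn => [/forallP gS|]; first by rewrite big1 // => i _; rewrite gS.
by rewrite negb_forall => /existsP[i /negPf gi]; rewrite (bigD1 i) //= gi.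
Qed.

Lemma mulmx_unit_swap (F : fieldType) p q (c : 'M[F]_p) (y : 'M[F]_q)
    (U V : 'M[F]_(p, q)) : c \in unitmx -> y \in unitmx ->
  (U *m invmx y == c *m V) = (V *m y == invmx c *m U).
Proof.
move=> cU yU; apply/eqP/eqP => [E|E].
  by rewrite -[V in LHS](mulKmx cU) -E -!mulmxA mulVmx ?mulmx1.
by rewrite -[U](mulKVmx cU) -E -mulmxA mulmxK.
Qed.

Section CycleCount.
Variables (K : finFieldType) (l k r N : nat).
Variables (x : 'I_l -> 'I_r * bool) (C : 'I_l -> 'M[K]_k).
Local Notation G := {'GL_N.+1[K]}.
Local Notation src := (edge_src x).
Local Notation tgt := (edge_tgt x).
Implicit Types (g : {ffun 'I_r -> G}) (X : 'M[K]_(l * k, N.+1)).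

Definition letter_val g (a : 'I_r * bool) : G :=
  (if a.2 then (g a.1)^-1 else g a.1)%g.

(** If the letter of the edge is the inverse of a generator, the orientation of
    the edge is opposite to the direction of the walk. *)
Definition edge_mx j := if (x j).2 then invmx (C j) else C j.

(** The equation imposed by the edge [j] on the blocks of [X]. *)
Definition step g X j : bool := blk_in K k j *m X *m GLval (letter_val g (x j)) ==
  C j *m (blk_in K k (ordS j) *m X).

Hypothesis C_unit : forall j, C j \in unitmx.
Hypothesis x_reduced : forall j, x (ordS j) != linv (x j).

Lemma edge_mx_unit j : edge_mx j \in unitmx.
Proof. by rewrite /edge_mx; case: ifP; rewrite ?unitmx_inv. Qed.

Lemma stepE g X j : step g X j =
  (blk_in K k (src j) *m X *m GLval (g (x j).1) ==
   edge_mx j *m (blk_in K k (tgt j) *m X)).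
Proof.
rewrite /step /edge_src /edge_tgt /edge_mx /letter_val; case: (x j).2 => //.
by rewrite GL_VxE mulmx_unit_swap //; apply: (valP (g _)).
Qed.

Local Notation span b := (blk_span K k (gen_src x b)).
Local Notation trans b := (transport x edge_mx b).

(** The equations of all edges with label [b] involve [g] only through [g b], and
    combine to a single equation for this matrix. *)
Lemma steps_transport g X : [forall j, step g X j] =
  [forall b, span b *m X *m GLval (g b) == trans b *m X].
Proof.
apply/forallP/forallP => [st b|tr j].
  rewrite /blk_span big_gen_src // /transport !mulmx_suml; apply/eqP/eq_bigr.
  move=> j /eqP xj; have := st j; rewrite stepE xj => /eqP sj.
  by rewrite -!mulmxA -sj !mulmxA.
have /eqP/(congr1 (mulmx (blk_in K k (src j)))) := tr (x j).1.
rewrite !mulmxA blk_in_span gen_srcP blk_in_transport // => E.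
by rewrite stepE mulmxA E.
Qed.

Definition transporters b X := [set y : G | span b *m X *m GLval y == trans b *m X].

Lemma card_steps X :
  #|[set g | [forall j, step g X j]]| = (\prod_b #|transporters b X|)%N.
Proof.
rewrite -card_ffun_forall; apply: eq_card => g; rewrite !inE steps_transport.
by apply: eq_forallb => b; rewrite inE.
Qed.

Lemma rank_span_sum : (\sum_b \rank (span b) = l * k)%N.
Proof.
transitivity (\sum_(j < l) k)%N; last by rewrite sum_nat_const card_ord.
rewrite [RHS](partition_big (fun j => (x j).1) xpredT) //=.
by apply: eq_bigr => b _; rewrite rank_blk_span big_gen_src.
Qed.

Lemma transport_span b : span b *m trans b = trans b.
Proof.
rewrite {2}/transport mulmx_sumr; apply: eq_bigr => j /eqP xj.
by rewrite !mulmxA blk_span_out -xj gen_srcP.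
Qed.

(** Transport back along the edges inverts [transport] on the sources. *)
Lemma rank_transport b : \rank (trans b) = \rank (span b).
Proof.
apply/eqP; rewrite eqn_leq -{1}transport_span mxrankM_maxl /=.
pose back := \sum_(j | (x j).1 == b)
  blk_out K k (tgt j) *m invmx (edge_mx j) *m blk_in K k (src j).
suff <- : trans b *m back = span b by apply: mxrankM_maxl.
rewrite mulmx_suml /blk_span big_gen_src //; apply: eq_bigr => j /eqP xj.
rewrite mulmx_sumr (bigD1 j) ?xj //= big1 ?addr0 => [|i /andP[/eqP xi ij]].
  by rewrite !mulmxA -(mulmxA _ (blk_in _ _ _)) blk_inK mulmx1 mulmxK ?edge_mx_unit.
rewrite !mulmxA -(mulmxA _ (blk_in _ _ _)) blk_in_out ?mulmx0 ?mul0mx //.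
by apply: contraNneq ij => /(edge_tgt_inj x_reduced) ->; rewrite // xi.
Qed.

(** When [X] is a frame, its rows can be mapped to any vectors, and the equations
    for [g b] have a solution. *)
Lemma card_transporters_free X b : row_free X ->
  (#|transporters b X| * #|frames K (\rank (span b)) N.+1| = #|{: G}|)%N.
Proof.
move=> /row_freeP[B XB].
have XBT : span b *m X *m (B *m (trans b *m X)) = trans b *m X.
  by rewrite mulmxA -(mulmxA (span b)) XB mulmx1 mulmxA transport_span.
have rfX : row_free X by apply/row_freeP; exists B.
have rkX : \rank (span b *m X) = \rank (span b) by rewrite mxrankMfree.
have [|y y_unit yE] := @complete_unitmx _ _ _ (span b *m X) (B *m (trans b *m X)).
  by rewrite XBT !mxrankMfree // rank_transport.
have := @card_GL_transporter _ _ _ (span b *m X) (trans b *m X) (Sub y y_unit).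
by rewrite rkX; apply; rewrite /= -yE XBT.
Qed.

Variables (h : 'I_l -> nat) (h_inj : injective h) (hc : order_compatible x h).

(** The left kernel of [X] is stable under transport along the edges, since this is
    how the matrices [g b] act on linear combinations of rows. *)
Lemma rank_span_mul X g : [forall j, step g X j] ->
    (forall j, row_free (blk_in K k j *m X)) -> ~~ row_free X ->
  (\rank X < \sum_b \rank (span b *m X))%N.
Proof.
rewrite steps_transport => /forallP tr frX nfX.
have spanE p (Z : 'M_(p, l * k)) S : (Z <= blk_span K k S)%MS -> Z *m blk_span K k S = Z.
  by case/submxP => D ->; rewrite -mulmxA; congr (_ *m _); apply: eq_blk_out => j;
    rewrite -mulmxA !blk_span_out; case: ifP; rewrite ?mulmx0 // blk_span_out => ->.
have stable b : ((kermx X :&: span b) *m trans b <= kermx X)%MS.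
  apply/sub_kermxP; rewrite -mulmxA -(eqP (tr b)) !mulmxA spanE ?capmxSr //.
  by have /sub_kermxP -> := capmxSl (kermx X) (span b); rewrite mul0mx.
have trivial j : (kermx X :&: blk_span K k (pred1 j))%MS = 0.
  set Z := (_ :&: _)%MS; have ZX : Z *m X = 0 by apply/sub_kermxP/capmxSl.
  have ZE : Z = Z *m blk_out K k j *m blk_in K k j.
    by rewrite -[LHS](spanE _ Z (pred1 j) (capmxSr _ _)) /blk_span big_pred1_eq mulmxA.
  suff Zj : Z *m blk_out K k j = 0 by rewrite ZE Zj mul0mx.
  by apply: (row_free_inj (frX j)); rewrite mul0mx mulmxA -ZE.
have := rank_transport_lt x_reduced edge_mx_unit h_inj hc stable trivial.
rewrite kermx_eq0 => /(_ nfX); rewrite mxrank_ker => lt_ker.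
have sumE : (\sum_b \rank (span b *m X) +
    \sum_b \rank (kermx X :&: span b) = l * k)%N.
  rewrite -big_split -[RHS]rank_span_sum; apply: eq_bigr => b _ /=.
  by rewrite capmxC mxrank_mul_ker.
have := rank_leq_row X; lia.
Qed.

End CycleCount.

(** * Bounds for the number of solutions *)

Section CycleBounds.
Variables (R : realFieldType) (K : finFieldType) (l k r N : nat).
Variables (x : 'I_l -> 'I_r * bool) (C : 'I_l -> 'M[K]_k).
Local Notation G := {'GL_N.+1[K]}.
Local Notation n := (l * k)%N.
Local Notation span b := (blk_span K k (gen_src x b)).
Local Notation F b X := (#|transporters x C b X|).

(** The number of solutions [(g, X)] of the equations of all edges for which
    every block of [X] is a frame; the solutions [g] for given [X] are counted by
    [card_steps]. *)
Definition cycle_count : nat :=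
  (\sum_(X : 'M[K]_(n, N.+1) | [forall j, row_free (blk_in K k j *m X)])
     \prod_b F b X)%N.

Let Q : R := #|K|%:R ^+ N.+1.
(** Up to [l * k] random vectors of length [N.+1] are linearly dependent with at most
    this probability. *)
Definition defect : R := #|K|%:R ^+ n / #|K|%:R ^+ N.+1.
Let beta : R := 1 - defect.
Let T : R := #|{: G}|%:R ^+ r.

Hypothesis C_unit : forall j, C j \in unitmx.
Hypothesis x_reduced : forall j, x (ordS j) != linv (x j).
Variables (h : 'I_l -> nat) (h_inj : injective h) (hc : order_compatible x h).
Hypothesis defect_lt1 : defect < 1.

Let q_ge1 : (1 : R) <= #|K|%:R.
Proof. by rewrite ler1n; apply/card_gt0P; exists 0. Qed.
Let q_gt0 : (0 : R) < #|K|%:R. Proof. exact: lt_le_trans q_ge1. Qed.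
Let Q_gt0 : 0 < Q. Proof. exact: exprn_gt0. Qed.
Let beta_gt0 : 0 < beta. Proof. by rewrite subr_gt0. Qed.
Let T_gt0 : 0 < T.
Proof. by rewrite exprn_gt0 // ltr0n; apply/card_gt0P; exists 1%g. Qed.

Lemma frames_upper s : #|frames K s N.+1|%:R <= Q ^+ s :> R.
Proof. by rewrite -exprM mulnC -natrX ler_nat card_frames_le. Qed.

Lemma frames_lower s : (s <= n)%N -> Q ^+ s * beta <= #|frames K s N.+1|%:R :> R.
Proof.
case: s => [_|s le_sn].
  have -> : #|frames K 0 N.+1| = 1%N.
    rewrite -[RHS](expn0 #|K|) -[X in (_ ^ X)%N](mul0n N.+1) -card_mx.
    by apply: eq_card => X; rewrite !inE -row_leq_rank.
  by rewrite expr0 mul1r gerBl divr_ge0 ?exprn_ge0 // ltW.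
have := card_frames_ge K s.+1 N.+1; rewrite -(ler_nat R) natrD natrM !natrX.
rewrite mulnC exprM -/Q [_.-1]/= [(s * _)%N]mulnC exprM -/Q => le_Q.
have le_q : #|K|%:R ^+ s.+1 <= #|K|%:R ^+ n :> R by rewrite ler_weXn2l.
have -> : Q ^+ s.+1 * beta = Q ^+ s.+1 - #|K|%:R ^+ n * Q ^+ s.
  by rewrite /beta /defect -/Q exprS; field; rewrite gt_eqF.
rewrite lerBlDr; apply: le_trans le_Q _; rewrite lerD2l.
by rewrite ler_wpM2r // exprn_ge0 // ltW.
Qed.

Let Phi : R := \prod_b #|frames K (\rank (span b)) N.+1|%:R.

Lemma prod_frames_bounds (s : 'I_r -> nat) : (forall b, (s b <= n)%N) ->
  Q ^+ (\sum_b s b) * beta ^+ r <= \prod_b #|frames K (s b) N.+1|%:R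
    <= Q ^+ (\sum_b s b).
Proof.
move=> le_sn; rewrite -prodrXr.
have -> : beta ^+ r = \prod_(b < r) beta by rewrite prodr_const card_ord.
rewrite -big_split /=; apply/andP; split; apply: ler_prod => b _.
  by rewrite frames_lower // mulr_ge0 ?exprn_ge0 // ltW.
by rewrite frames_upper ler0n.
Qed.

Lemma prod_transporters_free (X : 'M[K]_(n, N.+1)) : row_free X ->
  (\prod_b F b X)%:R = T / Phi.
Proof.
move=> frX; have Phi_gt0 : 0 < Phi.
  apply: lt_le_trans (proj1 (andP (prod_frames_bounds _))); last first.
    by move=> b; apply: rank_leq_row.
  by rewrite mulr_gt0 ?exprn_gt0.
apply: (mulIf (lt0r_neq0 Phi_gt0)); rewrite divfK ?gt_eqF // natr_prod -big_split /=.
under eq_bigr do rewrite -natrM card_transporters_free //.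
by rewrite prodr_const card_ord.
Qed.

(** The exponent [(\rank X).+1] of [1 / Q] exceeds by one what the number of
    matrices with the same left kernel as [X] can make up for. *)
Lemma prod_transporters_nonfree (X : 'M[K]_(n, N.+1)) :
    [forall j, row_free (blk_in K k j *m X)] -> ~~ row_free X ->
  (\prod_b F b X)%:R <= T / beta ^+ r / Q * (Q ^+ \rank X)^-1.
Proof.
move=> /forallP frX nfX.
have rhs_ge0 : 0 <= T / beta ^+ r / Q * (Q ^+ \rank X)^-1.
  by rewrite !(mulr_ge0, invr_ge0, exprn_ge0) // ltW.
(* A solution [g] for [X] is needed for the rank inequality. *)
have [->//|F_neq0] := eqVneq (\prod_b F b X)%N 0%N.
move: (F_neq0); rewrite -{1}card_steps // -lt0n => /card_gt0P[g]; rewrite inE => st.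
have lt_rk := rank_span_mul C_unit x_reduced h_inj hc st frX nfX.
pose P : R := \prod_b #|frames K (\rank (span b *m X)) N.+1|%:R.
have /andP[P_ge _] : Q ^+ (\sum_b \rank (span b *m X)) * beta ^+ r <= P
    <= Q ^+ (\sum_b \rank (span b *m X)).
  by apply: prod_frames_bounds => b; apply: rank_leq_row.
have {}P_ge : Q ^+ (\rank X).+1 * beta ^+ r <= P.
  apply: le_trans P_ge; rewrite ler_wpM2r ?exprn_ge0 ?(ltW beta_gt0) //.
  by rewrite ler_weXn2l // exprn_ege1.
have P_gt0 : 0 < P by apply: lt_le_trans P_ge; rewrite mulr_gt0 ?exprn_gt0.
have : (\prod_b F b X)%:R <= T / P.
  rewrite ler_pdivlMr // natr_prod -big_split /=.
  have -> : T = \prod_(b < r) #|{: G}|%:R by rewrite prodr_const card_ord.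
  apply: ler_prod => b _; rewrite -natrM ler0n ler_nat.
  exact: card_GL_transporter_le.
move/le_trans; apply; rewrite -!mulrA ler_pM2l // -!invfM.
rewrite lef_pV2 ?posrE ?mulr_gt0 ?exprn_gt0 //.
apply: le_trans P_ge; rewrite exprS le_eqVlt; apply/orP; left; apply/eqP.
ring.
Qed.

(** For each of the at most [#|K| ^ (n * n)] possible left kernels of [X], there are
    at most [Q ^+ \rank X] matrices [X]. *)
Lemma sum_rank_inv :
  \sum_(X : 'M[K]_(n, N.+1)) (Q ^+ \rank X)^-1 <= (#|K| ^ (n * n))%:R.
Proof.
rewrite (partition_big (@kermx K n N.+1) xpredT) //= -card_mx -sum1_card natr_sum.
apply: ler_sum => W _; set s := (n - \rank W)%N.
apply: (@le_trans _ _ (\sum_(X : 'M[K]_(n, N.+1) | W *m X == 0) (Q ^+ s)^-1)).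
  rewrite [X in _ <= X]big_mkcond [X in X <= _]big_mkcond /=.
  apply: ler_sum => X _; case: eqP => [kX|_]; last first.
    by case: ifP; rewrite // invr_ge0 exprn_ge0 // ltW.
  have -> : W *m X == 0 by rewrite -kX mulmx_ker.
  by rewrite /s -kX mxrank_ker subKn // rank_leq_row.
rewrite sumr_const -[_ *+ _]mulr_natl ler_pdivrMr ?exprn_gt0 // mul1r.
rewrite -exprM [(N.+1 * s)%N]mulnC -natrX ler_nat; apply: leq_trans (card_annihilated N.+1 W).
by rewrite cardsE.
Qed.

(** Matrices [X] with independent rows contribute the ratio of two numbers of
    frames that are both about [Q ^+ n], and all others contribute about [1 / Q]
    together. *)
Theorem cycle_count_bounds :
  beta <= cycle_count%:R / T <=
  (beta ^+ r)^-1 + #|K|%:R ^+ (n * n) * (beta ^+ r)^-1 * Q^-1.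
Proof.
have /andP[Phi_ge Phi_le] : Q ^+ n * beta ^+ r <= Phi <= Q ^+ n.
  rewrite -[n in Q ^+ n](rank_span_sum K k x_reduced).
  by apply: prod_frames_bounds => b; apply: rank_leq_row.
have Phi_gt0 : 0 < Phi by apply: lt_le_trans Phi_ge; rewrite mulr_gt0 ?exprn_gt0.
have free_blocks (X : 'M[K]_(n, N.+1)) : row_free X -> [forall j, row_free (blk_in K k j *m X)].
  move=> /row_freeP[B XB]; apply/forallP => j; apply/row_freeP.
  by exists (B *m blk_out K k j); rewrite mulmxA -(mulmxA (blk_in _ _ _)) XB mulmx1 blk_inK.
have -> : cycle_count%:R / T = #|frames K n N.+1|%:R / Phi +
   (\sum_(X : 'M[K]_(n, N.+1) | [forall j, row_free (blk_in K k j *m X)] && ~~ row_free X)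
     \prod_b F b X)%:R / T.
  rewrite /cycle_count (bigID (fun X => row_free X)) /= natrD mulrDl; congr (_ + _).
  rewrite (eq_bigl (fun X => row_free X)) => [|X]; last first.
    by apply/andP/idP => [[]|frX] //; split=> //; apply: free_blocks.
  rewrite natr_sum (eq_bigr (fun=> T / Phi)) => [|X]; last exact: prod_transporters_free.
  rewrite sumr_const -[_ *+ _]mulr_natl mulrA mulrAC mulfK ?gt_eqF //.
  by rewrite cardsE.
have /frames_lower fl := leqnn n; have fu := frames_upper n.
apply/andP; split.
  apply: (@le_trans _ _ (#|frames K n N.+1|%:R / Phi)); last first.
    by rewrite lerDl divr_ge0 ?ler0n // ltW.
  rewrite ler_pdivlMr //; apply: le_trans fl; rewrite mulrC ler_wpM2r //.
  exact: ltW.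
apply: lerD.
  rewrite ler_pdivrMr //; apply: le_trans fu _.
  by rewrite mulrC ler_pdivlMr ?exprn_gt0.
rewrite ler_pdivrMr // natr_sum.
apply: (@le_trans _ _ (\sum_(X : 'M[K]_(n, N.+1)) T / beta ^+ r / Q * (Q ^+ \rank X)^-1)).
  rewrite [X in X <= _]big_mkcond /=; apply: ler_sum => X _.
  case: ifPn => [/andP[frX nfX]|_]; first exact: prod_transporters_nonfree.
  by rewrite !(mulr_ge0, invr_ge0, exprn_ge0) // ltW.
rewrite -mulr_sumr; apply: le_trans (ler_wpM2l _ sum_rank_inv) _.
  by rewrite !(mulr_ge0, invr_ge0, exprn_ge0) // ltW.
by rewrite natrX le_eqVlt; apply/orP; left; apply/eqP; ring.
Qed.

End CycleBounds.

(** * Non-powers in the free group *)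

(** Euclid's algorithm: the shorter of the two words is a prefix of the longer one,
    and what is left of the longer one still commutes with it. *)
Lemma commuting_words (T : eqType) (s t : seq T) : s ++ t = t ++ s ->
  exists p a b, s = flatten (nseq a p) /\ t = flatten (nseq b p).
Proof.
have [n] := ubnP (size s + size t); elim: n s t => // n IHn.
suff main (s t : seq T) : (size s <= size t)%N -> (size s + size t < n.+1)%N ->
    s ++ t = t ++ s -> exists p a b, s = flatten (nseq a p) /\ t = flatten (nseq b p).
  move=> s t lt_n st; have [le_st|/ltnW le_ts] := leqP (size s) (size t).
    exact: main.
  by have [||p [a [b [tp sp]]]] := main t s le_ts; rewrite 1?addnC //; exists p, b, a.
move=> le_st lt_n st; have [s0|s_neq0] := eqVneq s [::].
  by exists t, 0%N, 1%N; rewrite s0 /= cats0.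
have tE : t = s ++ drop (size s) t.
  by rewrite -[LHS](cat_take_drop (size s)) -(takel_cat s le_st) -st take_size_cat.
move: st lt_n; rewrite tE; set t' := drop _ _.
rewrite -catA => /(congr1 (drop (size s))); rewrite !drop_size_cat // => st' lt_n.
rewrite size_cat in lt_n; rewrite -size_eq0 -lt0n in s_neq0.
have [||p [a [b [sp tp]]]] := IHn s t'; [lia | exact: st' |].
by exists p, a, (a + b)%N; split=> //; rewrite nseqD flatten_cat -sp -tp.
Qed.

Section Words.
Variable r : nat.
Local Notation letter := ('I_r * bool)%type.
Implicit Types (a : letter) (s t : seq letter) (u v : free_group r).

Lemma reduced_catP s t : reduced (s ++ t) -> reduced s /\ reduced t.
Proof.
rewrite /reduced; case: s => // a s; rewrite cat_cons /= cat_path => /andP[-> pt].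
by split=> //; apply: path_sorted pt.
Qed.

Lemma word_mul_cat s t : reduced (s ++ t) -> word_mul s t = s ++ t.
Proof.
elim: s => // a s IHs; rewrite cat_cons => rst; rewrite /= -/(word_mul s t) IHs.
  exact: push_cons.
by move: rst; rewrite -cat1s => /reduced_catP[].
Qed.

Lemma fg_exp_word s n (rs : reduced s) : reduced (flatten (nseq n s)) ->
  fg_word (FreeWord rs ^+ n)%g = flatten (nseq n s).
Proof.
elim: n => // n IHn rsn; have [_ /IHn wn] := reduced_catP rsn.
by rewrite expgS /= wn word_mul_cat.
Qed.

(** This concerns the two ends of the word only: a word in the free group is
    reduced already. *)
Definition cyc_reduced s := if s is a :: s' then a != linv (last a s') else true.

Lemma cyclic_reduction u : exists p v, u = (p * v * p^-1)%g /\ cyc_reduced v.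
Proof.
have [n] := ubnP (size u); elim: n u => // n IHn [[|a s] ru] /= lt_n.
  by exists 1%g, (FreeWord ru); split=> //; rewrite mul1g invg1 mulg1.
have [a_last|] := eqVneq a (linv (last a s)); last first.
  by move=> cyc; exists 1%g, (FreeWord ru); split=> //; rewrite mul1g invg1 mulg1.
case: (lastP s) ru lt_n a_last => [|{}s b] ru lt_n a_last.
  by have := linv_neq a; rewrite -a_last eqxx.
rewrite last_rcons in a_last; have {a_last} bE : b = linv a by rewrite a_last linvK.
subst b; have rsb : reduced (rcons s (linv a)).
  by move: ru; rewrite -cat1s => /reduced_catP[].
have rs : reduced s by move: rsb; rewrite -cats1 => /reduced_catP[].
have [|p [v [sE cv]]] := IHn (FreeWord rs).
  by move: lt_n => /=; rewrite size_rcons; lia.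
pose A : free_group r := @FreeWord r [:: a] isT.
exists (A * p)%g, v; split=> //; rewrite invMg !mulgA -2!(mulgA A) -sE.
apply: val_inj; rewrite /= word_mul_push // word_mul_cat cats1 //.
by rewrite push_cons.
Qed.

(** If [v] equals a rotation of itself, the two pieces that the rotation exchanges
    commute and hence are powers of the same word. *)
Lemma rot_primitive v k : non_power v -> (0 < k < size v)%N -> rot k v <> v.
Proof.
case=> v_neq1 v_np k_range rotv.
have [p [c [d [takeE dropE]]]] :
    exists p c d, take k v = flatten (nseq c p) /\ drop k v = flatten (nseq d p).
  by apply: commuting_words; rewrite cat_take_drop -[LHS]rotv.
have c_gt0 : (0 < c)%N.
  case: c takeE => // /(congr1 size) /=.
  rewrite size_take; case: ltnP; lia.
have d_gt0 : (0 < d)%N.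
  by case: d dropE => // /(congr1 size); rewrite size_drop /=; lia.
have vE : fg_word v = flatten (nseq (c + d) p).
  by rewrite nseqD flatten_cat -takeE -dropE cat_take_drop.
have rv := fg_wordP v; have rp : reduced p.
  by move: rv; rewrite vE -[c]prednK // => /reduced_catP[].
apply: (v_np (FreeWord rp) (c + d)%N); first lia.
by apply: val_inj; rewrite /= fg_exp_word -?vE.
Qed.

Lemma cyclic_word_turn s : cyc_reduced s -> reduced s ->
  forall j, tnth (in_tuple s) (ordS j) != linv (tnth (in_tuple s) j).
Proof.
move=> cyc red j; have s0 := tnth (in_tuple s) j; rewrite !(tnth_nth s0) /=.
move: (nat_of_ord j) (ltn_ord j) => i; rewrite leq_eqVlt => /orP[/eqP il|il].
  rewrite il modnn -[i]/(i.+1.-1) il nth_last.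
  by case: (s) cyc il {j}.
rewrite modn_small //; case: (s) red il => // a s' /(pathP s0) red il.
exact: red.
Qed.

Lemma cyclic_word_primitive v : non_power v -> forall k, (0 < k < size v)%N ->
  exists j, tnth (in_tuple v) (iter k (@ordS _) j) != tnth (in_tuple v) j.
Proof.
move=> np k k_range; apply/existsP; apply: contraT; rewrite negb_exists => /forallP per.
case: (rot_primitive np k_range).
have a0 : letter := tnth (in_tuple v) (Ordinal (proj2 (andP k_range))).
apply: (@eq_from_nth _ a0); rewrite size_rot // => i i_lt.
have /negPn/eqP := per (Ordinal i_lt); rewrite !(tnth_nth a0) /= val_iter_ordS /= => <-.
rewrite nth_cat size_drop; have /andP[k_gt0 k_lt] := k_range.
have [lt_i|ge_i] := ltnP i (size v - k).
  by rewrite nth_drop addnC modn_small // addnC -ltn_subRL.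
have -> : ((i + k) %% size v)%N = (i - (size v - k))%N.
  rewrite -[RHS](@modn_small _ (size v)); last lia.
  by rewrite -[in RHS](modnDr _ (size v)); congr (_ %% _)%N; lia.
by rewrite nth_take //; lia.
Qed.

End Words.

(** * Intertwiners *)

Section Unrolling.
Variables (K : finFieldType) (k l N : nat) (C : 'M[K]_k).
Local Notation G := {'GL_N.+1[K]}.
Hypothesis l_gt0 : (0 < l)%N.
Variable y : nat -> G.

(** The transition from a block to the next: trivial except for the last
    one, which closes the cycle. *)
Definition cycle_mx (j : 'I_l) : 'M[K]_k := if j.+1 == l then C else 1%:M.

Let path i : G := (\prod_(0 <= t < i) y t)%g.

Let pathS i : path i.+1 = (path i * y i)%g.
Proof. by rewrite /path big_nat_recr. Qed.

Let path0 : path 0 = 1%g. Proof. by rewrite /path big_geq. Qed.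

Let unroll (M : 'M[K]_(k, N.+1)) : 'M[K]_(l * k, N.+1) :=
  \sum_j blk_out K k j *m (M *m GLval (path j)).

Let unrollE M j : blk_in K k j *m unroll M = M *m GLval (path j).
Proof.
rewrite mulmx_sumr (bigD1 j) //= big1 ?addr0 => [|i ij].
  by rewrite mulmxA blk_inK mul1mx.
by rewrite mulmxA blk_in_out ?mul0mx // eq_sym.
Qed.

(** The first block determines the others along the cycle; the equation for [M] is
    the last transition. *)
Lemma card_unroll (P : pred 'M[K]_(k, N.+1)) :
  #|[set M | P M & M *m GLval (path l) == C *m M]| =
  #|[set X | P (blk_in K k (Ordinal l_gt0) *m X) & [forall j : 'I_l,
      blk_in K k j *m X *m GLval (y j) == cycle_mx j *m (blk_in K k (ordS j) *m X)]]|.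
Proof.
(* The blocks of [unroll M] satisfy all transitions but the last, where the product
   [path l] over the whole cycle appears. *)
pose j0 := Ordinal l_gt0; have unroll0 M : blk_in K k j0 *m unroll M = M.
  by rewrite unrollE path0 GL_1E mulmx1.
have step_unroll M (j : 'I_l) :
    (blk_in K k j *m unroll M *m GLval (y j) ==
     cycle_mx j *m (blk_in K k (ordS j) *m unroll M)) =
    (M *m GLval (path j.+1) == cycle_mx j *m (M *m GLval (path (ordS j)))).
  by rewrite !unrollE pathS GL_MxE !mulmxA.
rewrite -(card_imset _ (can_inj unroll0)); apply: eq_card => X.
apply/imsetP/idP => [[M]|].
  rewrite !inE => /andP[PM /eqP solM] ->; rewrite unroll0 PM; apply/forallP => j.
  rewrite step_unroll /cycle_mx /=; have := ltn_ord j.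
  rewrite leq_eqVlt => /orP[/eqP jl|jl].
    by rewrite jl eqxx modnn path0 solM GL_1E mulmx1.
  by rewrite ltn_eqF // modn_small // mul1mx.
rewrite inE => /andP[PX /forallP stX].
pose M := blk_in K k j0 *m X.
have XE : X = unroll M.
  suff blkE i (il : (i < l)%N) : blk_in K k (Ordinal il) *m X = M *m GLval (path i).
    rewrite -[X]mul1mx -(sum_blk_out_in K l k) mulmx_suml; apply: eq_bigr => j _.
    by rewrite -mulmxA -blkE; congr (_ *m (blk_in _ _ _ *m _)); apply: val_inj.
  elim: i il => [|i IHi] il.
    by rewrite path0 GL_1E mulmx1 /M; congr (blk_in _ _ _ *m _); apply: val_inj.
  have il' := ltnW il; have := stX (Ordinal il'); rewrite IHi.
  rewrite pathS GL_MxE (mulmxA M) /cycle_mx /= ltn_eqF // mul1mx.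
  move/eqP ->; congr (blk_in _ _ _ *m _); apply: val_inj.
  by rewrite /= modn_small.
exists M => //; rewrite inE PX /=.
have l1l : (l.-1 < l)%N by rewrite prednK.
have := stX (Ordinal l1l); rewrite XE step_unroll /= prednK // modnn path0.
by rewrite GL_1E mulmx1 /cycle_mx /= prednK // eqxx.
Qed.

End Unrolling.

Section WordFrames.
Variables (K : finFieldType) (k r N : nat) (v : free_group r) (C : 'M[K]_k).
Local Notation G := {'GL_N.+1[K]}.
Local Notation l := (size v).
Local Notation x := (tnth (in_tuple v)).
Hypothesis l_gt0 : (0 < l)%N.
Implicit Type g : {ffun 'I_r -> G}.

Definition frame_sols (y : G) : {set 'M[K]_(k, N.+1)} :=
  [set M | row_free M & M *m GLval y == C *m M].

Lemma card_frame_sols g : #|frame_sols (fg_eval g v)| =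
  #|[set X : 'M[K]_(l * k, N.+1) | [forall j, row_free (blk_in K k j *m X)] &
     [forall j, step x (cycle_mx C) g X j]]|.
Proof.
pose a0 := tnth (in_tuple v) (Ordinal l_gt0).
rewrite /frame_sols /fg_eval (big_nth a0).
rewrite (@card_unroll _ _ _ _ C l_gt0 (fun t => letter_val g (nth a0 v t))
  (@row_free K k N.+1)).
apply: eq_card => X; rewrite !inE.
have -> : [forall j : 'I_l,
    blk_in K k j *m X *m GLval (letter_val g (nth a0 v j)) ==
    cycle_mx C j *m (blk_in K k (ordS j) *m X)] =
    [forall j, step x (cycle_mx C) g X j].
  by apply: eq_forallb => j; rewrite /step (tnth_nth a0).
apply/andP/andP => -[frX st]; split=> //; last exact: (forallP frX).
apply/forallP => j; have [t _ <-] := iter_ordS_onto (Ordinal l_gt0) j.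
elim: t => //= t; set i := iter _ _ _ => fr_i.
have /eqP st_i := forallP st i; rewrite -row_leq_rank.
apply: leq_trans (mxrankM_maxr (cycle_mx C i) _).
by rewrite -st_i row_leq_rank frames_act.
Qed.

Lemma sum_frame_sols : (forall j : 'I_l, cycle_mx C j \in unitmx) ->
    (forall j, x (ordS j) != linv (x j)) ->
  (\sum_(g : {ffun 'I_r -> G}) #|frame_sols (fg_eval g v)| =
     cycle_count N x (cycle_mx C))%N.
Proof.
move=> C_unit x_red.
under eq_bigr do rewrite card_frame_sols -sum1_card big_mkcond.
rewrite exchange_big /cycle_count [RHS]big_mkcond; apply: eq_bigr => X _ /=.
case: ifPn => frX.
  rewrite -card_steps // -sum1_card [RHS]big_mkcond; apply: eq_bigr => g _.
  by rewrite !inE frX.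
by rewrite big1 // => g _; rewrite inE (negPf frX).
Qed.

End WordFrames.

Section Intertwiners.
Variables (K : finFieldType) (n : nat) (C : 'M[K]_n).

(** The left kernel of [quo_mx W] is the row space of [W], so this is the matrix of
    the projection to the quotient by [W], and [quo_sec W] is the matrix of
    a section. *)
Definition quo_mx (W : 'M[K]_n) : 'M[K]_(n, \rank (cokermx W)) := col_base (cokermx W).
Definition quo_sec (W : 'M[K]_n) : 'M[K]_(\rank (cokermx W), n) := pinvmx (quo_mx W).
(** The map induced by [C] on the quotient by [W], if [W] is stable under
    [C]. *)
Definition quo_end (W : 'M[K]_n) := quo_sec W *m C *m quo_mx W.

Lemma sub_quo_mx p (U : 'M_(p, n)) W : (U <= W)%MS = (U *m quo_mx W == 0).
Proof.
rewrite submxE -{1}(mulmx_base (cokermx W)) mulmxA.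
apply/eqP/eqP => [U0|->]; last by rewrite mul0mx.
by apply: (row_free_inj (row_base_free (cokermx W))); rewrite U0 mul0mx.
Qed.

Lemma quo_secK W : quo_sec W *m quo_mx W = 1%:M.
Proof. by rewrite /quo_sec mulVpmx // col_base_full. Qed.

Lemma quo_sec_ann p (X : 'M_(n, p)) W : W *m X = 0 ->
  quo_mx W *m (quo_sec W *m X) = X.
Proof.
move=> WX; apply/eqP; rewrite -subr_eq0 mulmxA -{2}[X]mul1mx -mulmxBl.
have /submxP[D ->] : (quo_mx W *m quo_sec W - 1%:M <= W)%MS.
  by rewrite sub_quo_mx mulmxBl -mulmxA quo_secK mulmx1 mul1mx subrr.
by rewrite -mulmxA WX mulmx0.
Qed.

Lemma quo_endE W : stablemx W C -> quo_mx W *m quo_end W = C *m quo_mx W.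
Proof.
move=> WC; rewrite /quo_end -(mulmxA (quo_sec W)); apply: quo_sec_ann.
by rewrite mulmxA; apply/eqP; rewrite -sub_quo_mx.
Qed.

Variable N : nat.
Local Notation G := {'GL_N.+1[K]}.

Definition intertwiners (y : G) : {set 'M[K]_(n, N.+1)} :=
  [set X | X *m GLval y == C *m X].

(** Row spaces are represented by their canonical square matrices [<<W>>]. *)
Definition quotient_kernels : {set 'M[K]_n} :=
  [set W | [&& <<W>>%MS == W, stablemx W C & quo_end W \in unitmx]].

(** An intertwiner with left kernel [W] factors through the quotient by [W], and
    the second factor has independent rows. *)
Lemma quo_frame (W : 'M_n) X y : <<kermx X>>%MS = W -> X \in intertwiners y ->
  quo_sec W *m X \in frame_sols (quo_end W) y.
Proof.
move=> kX; rewrite !inE => /eqP Xy.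
have sub_W p (U : 'M_(p, n)) : (U <= W)%MS = (U <= kermx X)%MS by rewrite -kX genmxE.
apply/andP; split.
  rewrite -kermx_eq0; set U := kermx _.
  have : (U *m quo_sec W <= W)%MS.
    by rewrite sub_W; apply/sub_kermxP; rewrite -mulmxA mulmx_ker.
  by rewrite sub_quo_mx -mulmxA quo_secK mulmx1.
have WX : W *m X = 0 by apply/sub_kermxP; rewrite -sub_W.
by rewrite /quo_end -(mulmxA _ X) Xy -(mulmxA (_ *m C)) quo_sec_ann // mulmxA.
Qed.

Lemma frame_quo (W : 'M_n) M y : <<W>>%MS = W -> stablemx W C ->
  M \in frame_sols (quo_end W) y ->
  quo_mx W *m M \in intertwiners y /\ <<kermx (quo_mx W *m M)>>%MS = W.
Proof.
move=> genW WC; rewrite !inE => /andP[frM /eqP My]; split.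
  by rewrite -mulmxA My (mulmxA (quo_mx W)) quo_endE // -(mulmxA C).
rewrite -[RHS]genW; apply/genmxP/andP; split.
  rewrite sub_quo_mx; apply/eqP/(row_free_inj frM).
  by rewrite -mulmxA mulmx_ker mul0mx.
apply/sub_kermxP; rewrite mulmxA; have := submx_refl W.
by rewrite sub_quo_mx => /eqP ->; rewrite mul0mx.
Qed.

(** The induced map on the quotient is invertible since it takes a frame to the
    frame obtained from it by the action of [y]. *)
Lemma kermx_intertwiner X y : X \in intertwiners y -> <<kermx X>>%MS \in quotient_kernels.
Proof.
move=> Xy; have := quo_frame erefl Xy; move: Xy; rewrite !inE => /eqP Xy /andP[frM /eqP My].
rewrite genmx_id eqxx /=; apply/andP; split.
  rewrite (eqmxMr C (genmxE _)) genmxE; apply/sub_kermxP.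
  by rewrite -mulmxA -Xy mulmxA mulmx_ker mul0mx.
rewrite -row_free_unit -row_leq_rank; 
apply: leq_trans (mxrankM_maxl _ (quo_sec <<kermx X>>%MS *m X)); rewrite -My.
by rewrite row_leq_rank frames_act.
Qed.

Lemma card_intertwiners y : #|intertwiners y| =
  (\sum_(W in quotient_kernels) #|frame_sols (quo_end W) y|)%N.
Proof.
rewrite -sum1_card (partition_big (fun X => <<kermx X>>%MS) (mem quotient_kernels)) /=.
  apply: eq_bigr => W; rewrite inE => /and3P[/eqP genW stabW unitW].
  rewrite sum1dep_card.
  have inj : injective (mulmx (quo_mx W) : 'M_(_, N.+1) -> _).
    by apply: (@can_inj _ _ _ (mulmx (quo_sec W))) => R; rewrite mulmxA quo_secK mul1mx.
  rewrite -(card_imset _ inj); apply: eq_card => X; rewrite inE.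
  apply/andP/imsetP => [[Xy /eqP kX]|[M /frame_quo[]// Xy kX ->]]; last first.
    by rewrite Xy kX.
  exists (quo_sec W *m X); first exact: quo_frame.
  by rewrite quo_sec_ann //; apply/sub_kermxP; rewrite -kX genmxE.
by move=> X; apply: kermx_intertwiner.
Qed.

End Intertwiners.

(** The block companion matrix of [x^d - B], acting on row vectors. *)
Definition companion (K : finFieldType) m d (B : 'M[K]_m) : 'M[K]_(d * m) :=
  \sum_j blk_out K m j *m cycle_mx B j *m blk_in K m (ordS j).

Lemma blk_in_companion (K : finFieldType) m d (B : 'M[K]_m) (j : 'I_d) :
  blk_in K m j *m companion d B = cycle_mx B j *m blk_in K m (ordS j).
Proof.
rewrite mulmx_sumr (bigD1 j) //= big1 ?addr0 => [|i ij].
  by rewrite !mulmxA blk_inK mul1mx.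
by rewrite !mulmxA blk_in_out ?mul0mx // eq_sym.
Qed.

(** [M] corresponds to the matrix with blocks [M, M y, ..., M y^(d-1)]. *)
Lemma card_power_intertwiners (K : finFieldType) m d N (B : 'M[K]_m)
    (y : {'GL_N.+1[K]}) : (0 < d)%N ->
  #|intertwiners B (y ^+ d)%g| = #|intertwiners (companion d B) y|.
Proof.
move=> d_gt0; have -> : (y ^+ d)%g = (\prod_(0 <= t < d) y)%g.
  elim: (d) => [|i IHi]; first by rewrite big_geq.
  by rewrite big_nat_recr // -IHi expgSr.
rewrite /intertwiners; have := @card_unroll _ _ _ _ B d_gt0 (fun=> y) xpredT => /= ->.
apply: eq_card => X; rewrite !inE; apply/forallP/eqP => [st|E j].
  apply: (@eq_blk_in K d m) => j.
  by rewrite !(mulmxA (blk_in K m j)) (eqP (st j)) blk_in_companion -mulmxA.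
by rewrite -mulmxA E (mulmxA (blk_in K m j)) blk_in_companion -mulmxA.
Qed.

(** * Limits *)

Local Open Scope classical_set_scope.

Section Limits.
Variable R : realType.

Lemma cvg_exprn (f : nat -> R) (a : R) n :
  f @ \oo --> a -> (fun i => f i ^+ n) @ \oo --> a ^+ n.
Proof.
move=> fa; elim: n => [|n IHn].
  by under eq_fun do rewrite expr0; rewrite expr0; apply: cvg_cst.
by under eq_fun do rewrite exprS; rewrite exprS; apply: cvgM.
Qed.

Lemma cvg_finsum (I : Type) (s : seq I) (P : pred I) (f : I -> nat -> R) (a : I -> R) :
  (forall i, P i -> f i @ \oo --> a i) ->
  (fun n => \sum_(i <- s | P i) f i n) @ \oo --> \sum_(i <- s | P i) a i.
Proof.
move=> fa; elim: s => [|i s IHs].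
  by under eq_fun do rewrite big_nil; rewrite big_nil; apply: cvg_cst.
under eq_fun do rewrite big_cons; rewrite big_cons.
by case: ifP => // Pi; apply: cvgD => //; apply: fa.
Qed.

Lemma word_expectationS (K : finFieldType) (r N : nat) (w : free_group r)
    (f : {'GL_N[K]} -> nat) : word_expectation R w f =
  (\sum_(g : {ffun 'I_r -> {'GL_N[K]}}) f (fg_eval g w))%N%:R /
    #|{: {'GL_N[K]}}|%:R ^+ r.
Proof. by rewrite /word_expectation -natr_sum card_ffun card_ord natrX. Qed.

(** By [cycle_count_bounds], applied to the cyclic word [v] with a stacking. *)
Lemma frame_expectation_cvg (K : finFieldType) (k r : nat) (v : free_group r)
    (C : 'M[K]_k) : non_power v -> cyc_reduced v -> C \in unitmx ->
  (fun N => word_expectation R v (fun y : {'GL_N.+1[K]} => #|frame_sols C y|))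
    @ \oo --> (1 : R).
Proof.
move=> np cyc C_unit.
have v_gt0 : (0 < size v)%N.
  rewrite lt0n; apply/eqP => /size0nil v0; case: np => v_neq1 _; apply: v_neq1.
  exact: val_inj.
have turn := cyclic_word_turn cyc (fg_wordP v).
have cycle_unit (j : 'I_(size v)) : cycle_mx C j \in unitmx.
  by rewrite /cycle_mx; case: ifP; rewrite ?unitmx1.
have [h [hc h_inj]] := stacking_exists turn (cyclic_word_primitive np).
set n := (size v * k)%N.
have q_gt1 : (1 : R) < #|K|%:R by rewrite ltr1n card_finNzRing_gt1.
have q_gt0 : (0 : R) < #|K|%:R by rewrite ltr0n ltnW // card_finNzRing_gt1.
have Qinv_cvg : (fun N => (#|K|%:R ^+ N.+1)^-1 : R) @ \oo --> (0 : R).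
  have : (fun N => (#|K|%:R^-1) ^+ N : R) @ \oo --> (0 : R).
    by apply: cvg_expr; rewrite gtr0_norm ?invr_gt0 // invf_lt1.
  by rewrite -cvg_shiftS; under eq_fun do rewrite exprVn.
have defect_cvg : (fun N => defect R K (size v) k N) @ \oo --> (0 : R).
  by rewrite -(mulr0 (#|K|%:R ^+ n)); apply: cvgM => //; apply: cvg_cst.
have beta_cvg : (fun N => 1 - defect R K (size v) k N) @ \oo --> (1 : R).
  by rewrite -[X in _ --> X]subr0; apply: cvgB => //; apply: cvg_cst.
have betaV_cvg : (fun N => ((1 - defect R K (size v) k N) ^+ r)^-1) @ \oo --> (1 : R).
  have : (fun N => ((1 - defect R K (size v) k N) ^+ r)^-1) @ \oo --> ((1 : R) ^+ r)^-1.
    by apply: cvgV; [rewrite expr1n oner_neq0 | apply: cvg_exprn].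
  by rewrite expr1n invr1.
pose upper N : R := ((1 - defect R K (size v) k N) ^+ r)^-1 +
  #|K|%:R ^+ (n * n) * ((1 - defect R K (size v) k N) ^+ r)^-1 *
  (#|K|%:R ^+ N.+1)^-1.
apply: (@squeeze_cvgr _ _ _ _ (fun N => 1 - defect R K (size v) k N) upper) => //.
  have : \forall N \near \oo, defect R K (size v) k N < 1.
    exact: (cvgr_lt 0 defect_cvg).
  apply: filterS => N defect_lt1.
  rewrite word_expectationS sum_frame_sols //.
  exact: (cycle_count_bounds cycle_unit turn h_inj hc defect_lt1).
rewrite -[X in _ --> X]addr0; apply: cvgD => //.
by rewrite -(mulr0 (#|K|%:R ^+ (n * n) * 1)); apply: cvgM => //; apply: cvgM => //; apply: cvg_cst.
Qed.

Lemma card_intertwiners_conj (K : finFieldType) n (C : 'M[K]_n) N (p y : {'GL_N.+1[K]}) :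
  #|intertwiners C (p * y * p^-1)%g| = #|intertwiners C y|.
Proof.
have pU : GLval p \in unitmx := valP p.
have pK : injective (fun X : 'M[K]_(n, N.+1) => X *m GLval p).
  by apply: (@can_inj _ _ _ (fun X => X *m invmx (GLval p))) => X; rewrite mulmxK.
rewrite -(card_imset _ pK); apply: eq_card => Y; rewrite inE.
apply/imsetP/eqP => [[X + ->]|YE].
  rewrite inE !GL_MxE GL_VxE => /eqP XE.
  by rewrite mulmxA -XE !mulmxA mulmxKV.
exists (Y *m invmx (GLval p)); last by rewrite mulmxKV.
by rewrite inE !GL_MxE GL_VxE !mulmxA mulmxKV // YE.
Qed.

Lemma fg_evalX r (G : groupType) (g : 'I_r -> G) (u : free_group r) d :
  fg_eval g (u ^+ d)%g = (fg_eval g u ^+ d)%g.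
Proof.
elim: d => [|d IHd]; last by rewrite !expgS fg_evalM IHd.
by rewrite !expg0 /fg_eval big_nil.
Qed.

Lemma fg_evalV r (G : groupType) (g : 'I_r -> G) (u : free_group r) :
  fg_eval g u^-1%g = (fg_eval g u)^-1%g.
Proof.
apply: (@mulIg _ (fg_eval g u)); rewrite -fg_evalM !mulVg.
by rewrite /fg_eval big_nil.
Qed.

Lemma non_power_conj r (p v : free_group r) : non_power (p * v * p^-1)%g -> non_power v.
Proof.
have conjE z : (p * z * p^-1 = z ^ p^-1)%g by rewrite conjgE invgK mulgA.
case=> u_neq1 u_np; split=> [v1|z n n_ge2 vz]; first by rewrite v1 conjE conj1g in u_neq1.
by apply: (u_np (z ^ p^-1)%g n n_ge2); rewrite vz conjE conjXg.
Qed.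

(** Each possible left kernel contributes 1 to the limit. *)
Theorem intertwiner_expectation_cvg (K : finFieldType) m (B : 'M[K]_m)
    (r : nat) (u : free_group r) d : non_power u -> (0 < d)%N ->
  (fun N => word_expectation R (u ^+ d)%g (fun y : {'GL_N.+1[K]} => #|intertwiners B y|))
    @ \oo --> (#|quotient_kernels (companion d B)|%:R : R).
Proof.
move=> np_u d_gt0; have [p [v [uE cyc]]] := cyclic_reduction u.
have np_v : non_power v by apply: (@non_power_conj _ p); rewrite -uE.
have expE N : word_expectation R (u ^+ d)%g (fun y : {'GL_N.+1[K]} => #|intertwiners B y|) =
    \sum_(W in quotient_kernels (companion d B))
       word_expectation R v (fun y : {'GL_N.+1[K]} => #|frame_sols (quo_end (companion d B) W) y|).
  rewrite word_expectationS; under [RHS]eq_bigr do rewrite word_expectationS.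
  rewrite -mulr_suml -natr_sum; congr (_%:R / _).
  rewrite exchange_big; apply: eq_bigr => g _ /=.
  rewrite fg_evalX card_power_intertwiners // uE !fg_evalM fg_evalV card_intertwiners_conj.
  exact: card_intertwiners.
under eq_fun do rewrite expE.
rewrite -sum1_card natr_sum; apply: cvg_finsum => W; rewrite inE => /and3P[_ _ W_unit].
exact: frame_expectation_cvg.
Qed.
End Limits.

Theorem theorem1p12 (R : realType) (K : finFieldType) (m : nat)
    (m_gt0 : (0 < m)%N) (B : {'GL_m[K]}) :
  exists L : nat -> R,
    forall (r : nat) (r_gt0 : (0 < r)%N) (w u : free_group r) (d : nat)
      (d_gt0 : (0 < d)%N) (w_neq1 : w <> 1%g) (u_nonpow : non_power u)
      (w_eq : w = (u ^+ d)%g),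
      (fun N : nat => word_expectation R w (@count_intertwiners K m B N))
        @ \oo --> L d.
Proof.
exists (fun d => #|quotient_kernels (companion d (GLval B))|%:R).
move=> r _ w u d d_gt0 _ np_u ->; rewrite -cvg_shiftS.
exact: intertwiner_expectation_cvg.
Qed.
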